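(* Let $N\geq 1$ be an integer, $\Bbbk$ a field, and $\mathcal{O}_N=\Bbbk[[T_1,\dots,T_N]]$. Let $P\in\mathcal{O}_N[X_1,\dots,X_n]$ be a homogeneous polynomial of degree $d$ whose only zero in $\mathcal{O}_N^n$ is $(0,\dots,0)$. For $i\in\{1,\dots,n\}$ let $Q_i(X_1,\dots,X_{i-1},X_{i+1},\dots,X_n)$ denote the polynomial $P(X_1,\dots,X_{i-1},1,X_{i+1},\dots,X_n)$ obtained from $P$ by replacing $X_i$ by $1$. Then the Artin function of $P$ is bounded above by an affine function if and only if there exist two positive constants $a$ and $b$ such that $$\min_{j\neq i}\left\{\mathrm{ord}\left(\frac{u_j}{v}-y_j\right)\right\}\leq a\,\mathrm{ord}(v)+b$$ for every $i\in\{1,\dots,n\}$, every root $(y_j)_{j\in\{1,\dots,n\}\setminus\{i\}}$ of $Q_i$ with all coordinates in $\widehat{V}_N$, all $u_j\in\mathcal{O}_N$ ($j\in\{1,\dots,n\}\setminus\{i\}$) and all nonzero $v\in\mathcal{O}_N$.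
   Context: $\mathcal{O}_N=\Bbbk[[T_1,\dots,T_N]]$ has maximal ideal $\mathfrak{m}_N=(T_1,\dots,T_N)$, and $\mathrm{ord}$ denotes the $\mathfrak{m}_N$-adic valuation on $\mathcal{O}_N$ (with $\mathrm{ord}(0)=+\infty$), extended to the fraction field $\mathbb{K}_N$ of $\mathcal{O}_N$ by $\mathrm{ord}(x/y)=\mathrm{ord}(x)-\mathrm{ord}(y)$. $V_N:=\{x/y : x,y\in\mathcal{O}_N,\ y\neq 0,\ \mathrm{ord}(x)\geq\mathrm{ord}(y)\}$ is the discrete valuation ring of $\mathrm{ord}$ dominating $\mathcal{O}_N$. $\widehat{V}_N:=\Bbbk\left(\frac{T_1}{T_N},\dots,\frac{T_{N-1}}{T_N}\right)[[T_N]]$ is the completion of $V_N$ for the adic topology of its maximal ideal. $\widehat{\mathbb{K}}_N$ is the fraction field of $\widehat{V}_N$; it is the completion of $\mathbb{K}_N$, and $\mathrm{ord}$ also denotes the extended valuation on $\widehat{V}_N$ and $\widehat{\mathbb{K}}_N$ (the $T_N$-adic valuation). Artin function. Let $I$ be an ideal of $\mathcal{O}_N[X_1,\dots,X_n]$ generated by $f_1,\dots,f_r$. By Artin's strong approximation theorem there exists a function $\beta:\mathbb{N}\to\mathbb{N}$ such that for every $i\in\mathbb{N}$ and every $x\in\mathcal{O}_N^n$ with $f_l(x)\in\mathfrak{m}_N^{\beta(i)+1}$ for all $l$, there exists $\overline{x}\in\mathcal{O}_N^n$ with $f_l(\overline{x})=0$ for all $l$ and $\overline{x}-x\in\mathfrak{m}_N^{i+1}\mathcal{O}_N^n$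 (coordinatewise). The Artin function of $I$ is the smallest (pointwise) function $\beta:\mathbb{N}\to\mathbb{N}$ with this property. The Artin function of a polynomial is the Artin function of the principal ideal it generates. An affine function is a function $i\mapsto \lambda i+\mu$ with real constants $\lambda,\mu$. *)

(* Defs.v *)
From HB Require Import structures.
From mathcomp Require Import all_boot all_order all_algebra fraction generic_quotient.
From mathcomp Require Import mpoly.
From mathcomp Require Import boolp reals constructive_ereal.

Set Implicit Arguments.
Unset Strict Implicit.
Unset Printing Implicit Defensive.

Import Order.TTheory GRing.Theory Num.Theory.
Local Open Scope ring_scope.
Local Open Scope quotient_scope.

Notation "x %:F" := (tofrac x) : ring_scope.

(* A power series in n variables is the family of its coefficients, indexed by
   the monomials 'X_{1..n} of the multinomials library. *)
Record powser (n : nat) (R : Type) := PowSer { pscoef : 'X_{1..n} -> R }.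

Notation "{ 'powser' R [ n ] }" := (powser n R)
  (at level 0, R at level 2, n at level 2, format "{ 'powser'  R [ n ] }").

HB.instance Definition _ n R := gen_eqMixin {powser R[n]}.
HB.instance Definition _ n R := gen_choiceMixin {powser R[n]}.

Lemma powserP n R (f g : {powser R[n]}) : pscoef f =1 pscoef g -> f = g.
Proof. by case: f g => [f] [g] /= /funext ->. Qed.

Section Zmod.
Variables (n : nat) (R : zmodType).
Implicit Types f g h : {powser R[n]}.

Definition ps_zero : {powser R[n]} := PowSer (fun=> 0).
Definition ps_opp f : {powser R[n]} := PowSer (fun m => - pscoef f m).
Definition ps_add f g : {powser R[n]} :=
  PowSer (fun m => pscoef f m + pscoef g m).

Let addA : associative ps_add.
Proof. by move=> f g h; apply: powserP => m /=; rewrite addrA. Qed.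
Let addC : commutative ps_add.
Proof. by move=> f g; apply: powserP => m /=; rewrite addrC. Qed.
Let add0 : left_id ps_zero ps_add.
Proof. by move=> f; apply: powserP => m /=; rewrite add0r. Qed.
Let addN : left_inverse ps_zero ps_opp ps_add.
Proof. by move=> f; apply: powserP => m /=; rewrite addNr. Qed.

HB.instance Definition _ :=
  GRing.isZmodule.Build {powser R[n]} addA addC add0 addN.

Lemma pscoef0 m : pscoef (0 : {powser R[n]}) m = 0. Proof. by []. Qed.
Lemma pscoefD f g m : pscoef (f + g) m = pscoef f m + pscoef g m.
Proof. by []. Qed.
Lemma pscoefN f m : pscoef (- f) m = - pscoef f m. Proof. by []. Qed.
Lemma pscoefB f g m : pscoef (f - g) m = pscoef f m - pscoef g m.
Proof. by []. Qed.
Lemma pscoef_sum I (r : seq I) (P : pred I) (F : I -> {powser R[n]}) m :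
  pscoef (\sum_(i <- r | P i) F i) m = \sum_(i <- r | P i) pscoef (F i) m.
Proof. by elim/big_rec2: _ => // i x y _ <-. Qed.

End Zmod.

Section Ring.
Variables (n : nat) (R : comNzRingType).
Implicit Types (f g h : {powser R[n]}) (m : 'X_{1..n}) (D d : nat).

Definition ps_one : {powser R[n]} := PowSer (fun m => (m == 0%MM)%:R).
Definition ps_mul f g : {powser R[n]} := PowSer (fun m =>
  \sum_(k : 'X_{1..n < (mdeg m).+1, (mdeg m).+1} | m == (k.1 + k.2)%MM)
    pscoef f k.1 * pscoef g k.2).

(* Truncation below degree D; the ring laws are inherited from {mpoly R[n]}
   through ps_mulE. *)
Definition ps_trunc D f : {mpoly R[n]} :=
  \sum_(m : 'X_{1..n < D}) pscoef f m *: 'X_[m].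

Lemma mcoeff_trunc D f m :
  (ps_trunc D f)@_m = if (mdeg m < D)%N then pscoef f m else 0.
Proof.
case: ifP => [|ltmD]; first exact: mcoeff_mpoly.
rewrite raddf_sum big1 //= => k _; rewrite mcoeffZ mcoeffX.
by case: eqP => [e|_]; rewrite ?mulr0 //; move: (bmdeg k); rewrite e ltmD.
Qed.

Let mcoeffM_agree (p p' q q' : {mpoly R[n]}) m :
    (forall k, (mdeg k <= mdeg m)%N -> p@_k = p'@_k) ->
    (forall k, (mdeg k <= mdeg m)%N -> q@_k = q'@_k) ->
  (p * q)@_m = (p' * q')@_m.
Proof.
move=> pp' qq'; rewrite !mcoeffM; apply: eq_bigr => k _.
by rewrite pp' ?qq' // -ltnS bmdeg.
Qed.

Lemma ps_mulE D f g m : (mdeg m < D)%N ->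
  pscoef (ps_mul f g) m = (ps_trunc D f * ps_trunc D g)@_m.
Proof.
move=> ltmD; rewrite mcoeffM; apply: eq_bigr => -[k1 k2] _ /=.
have lt (k : 'X_{1..n < (mdeg m).+1}) : (mdeg k < D)%N.
  exact: leq_trans (bmdeg k) ltmD.
by rewrite !mcoeff_trunc !lt.
Qed.

Let mulC : commutative ps_mul.
Proof.
move=> f g; apply: powserP => m.
by rewrite !(ps_mulE _ _ (ltnSn _)) mulrC.
Qed.

Let mulA : associative ps_mul.
Proof.
move=> f g h; apply: powserP => m; set D := (mdeg m).+1.
have trM f1 f2 k : (mdeg k <= mdeg m)%N ->
    (ps_trunc D (ps_mul f1 f2))@_k = (ps_trunc D f1 * ps_trunc D f2)@_k.
  by move=> lek; rewrite mcoeff_trunc ltnS lek (@ps_mulE D).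
rewrite !(@ps_mulE D) //.
rewrite (mcoeffM_agree (fun _ _ => erefl) (trM g h)) mulrA.
by rewrite (mcoeffM_agree (trM f g) (fun _ _ => erefl)).
Qed.

Let trunc1 D : ps_trunc D.+1 ps_one = 1.
Proof.
apply/mpolyP => k; rewrite mcoeff_trunc mcoeff1 /=.
by case: eqP => [->|]; rewrite ?mdeg0 //= if_same.
Qed.

Let mul1 : left_id ps_one ps_mul.
Proof.
move=> f; apply: powserP => m; rewrite (ps_mulE _ _ (ltnSn _)) trunc1 mul1r.
by rewrite mcoeff_trunc ltnSn.
Qed.

Let mulDl : left_distributive ps_mul +%R.
Proof.
move=> f g h; apply: powserP => m /=; rewrite -big_split /=.
by apply: eq_bigr => k _; rewrite mulrDl.
Qed.

Let oner_neq0 : ps_one != 0.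
Proof.
apply/eqP => /(congr1 (fun f => pscoef f 0%MM)) /=.
by rewrite eqxx => /eqP; rewrite oner_eq0.
Qed.

HB.instance Definition _ := GRing.Zmodule_isComNzRing.Build {powser R[n]}
  mulA mulC mul1 mulDl oner_neq0.

Lemma pscoef1 m : pscoef (1 : {powser R[n]}) m = (m == 0%MM)%:R.
Proof. by []. Qed.

Lemma pscoefM f g m : pscoef (f * g) m =
  \sum_(k : 'X_{1..n < (mdeg m).+1, (mdeg m).+1} | m == (k.1 + k.2)%MM)
    pscoef f k.1 * pscoef g k.2.
Proof. by []. Qed.

Definition ps_unit := [pred f : {powser R[n]} | `[< exists g, g * f = 1 >]].
Definition ps_inv f : {powser R[n]} :=
  if pselect (exists g, g * f = 1) is left e then projT1 (cid e) else f.

Let mulVx : {in ps_unit, left_inverse 1 ps_inv *%R}.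
Proof.
move=> f /asboolP uf; rewrite /ps_inv; case: pselect => // e.
by case: (cid e).
Qed.

Let unitP f g : g * f = 1 -> ps_unit f.
Proof. by move=> gf; apply/asboolP; exists g. Qed.

Let invN : {in [predC ps_unit], ps_inv =1 id}.
Proof.
move=> f; rewrite inE /= => /asboolPn nf; rewrite /ps_inv.
by case: pselect.
Qed.

HB.instance Definition _ :=
  GRing.ComNzRing_hasMulInverse.Build {powser R[n]} mulVx unitP invN.

(* The homogeneous component of degree d. *)
Definition ps_hcomp d f : {mpoly R[n]} :=
  \sum_(m : 'X_{1..n < d.+1} | mdeg m == d) pscoef f m *: 'X_[m].

Lemma mcoeff_hcomp d f m :
  (ps_hcomp d f)@_m = if mdeg m == d then pscoef f m else 0.
Proof.
have -> : ps_hcomp d f =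
    ps_trunc d.+1 (PowSer (fun m => if mdeg m == d then pscoef f m else 0)).
  rewrite /ps_hcomp big_mkcond /=; apply: eq_bigr => k _ /=.
  by case: ifP => // _; rewrite scale0r.
by rewrite mcoeff_trunc /=; case: eqP => [->|]; rewrite ?ltnSn ?if_same.
Qed.

Lemma ps_hcompM f g d e :
    (forall m, (mdeg m < d)%N -> pscoef f m = 0) ->
    (forall m, (mdeg m < e)%N -> pscoef g m = 0) ->
  ps_hcomp (d + e) (f * g) = ps_hcomp d f * ps_hcomp e g.
Proof.
move=> f0 g0; apply/mpolyP => m; rewrite mcoeff_hcomp mcoeffM.
case: eqP => [dm|/eqP dm].
  apply: eq_bigr => -[a b] /= /eqP mab; rewrite !mcoeff_hcomp.
  have dab : (mdeg a + mdeg b = d + e)%N by rewrite -mdegD -mab.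
  case: (ltngtP (mdeg a) d) => [lt|gt|eqa].
  - by rewrite f0 ?mul0r.
  - rewrite (g0 b) ?mulr0 ?mul0r //.
    by rewrite -(ltn_add2l (mdeg a)) dab ltn_add2r.
  - by move: dab; rewrite eqa => /addnI ->; rewrite eqxx.
rewrite big1 // => -[a b] /= /eqP mab; rewrite !mcoeff_hcomp.
case: eqP => [da|]; last by rewrite mul0r.
case: eqP => [db|]; last by rewrite mulr0.
by case/eqP: dm; rewrite [in LHS]mab mdegD da db.
Qed.

Lemma pscoefM_lt f g d e :
    (forall m, (mdeg m < d)%N -> pscoef f m = 0) ->
    (forall m, (mdeg m < e)%N -> pscoef g m = 0) ->
  forall m, (mdeg m < d + e)%N -> pscoef (f * g) m = 0.
Proof.
move=> f0 g0 m ltm; rewrite pscoefM big1 // => -[a b] /= /eqP mab.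
case: (ltnP (mdeg a) d) => [lt|le]; first by rewrite f0 ?mul0r.
rewrite (g0 b) ?mulr0 // -(ltn_add2l d).
have dab : (mdeg a + mdeg b)%N = mdeg m by rewrite -mdegD -mab.
by apply: leq_ltn_trans ltm; apply: leq_trans (eq_leq dab); rewrite leq_add2r.
Qed.

Definition ps_var (j : 'I_n) : {powser R[n]} :=
  PowSer (fun m => (m == U_(j)%MM)%:R).

Lemma pscoef_varM j f m : pscoef (ps_var j * f) m =
  if (0 < m j)%N then pscoef f (m - U_(j))%MM else 0.
Proof.
case: ifP => [mj|mj]; last first.
  rewrite pscoefM big1 // => -[a b] /= /eqP mab.
  case: eqP => [ea|]; last by rewrite mul0r.
  have : (0 < (a + b)%MM j)%N by rewrite ea mnmDE mnm1E eqxx.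
  by rewrite -mab mj.
have -> : pscoef (ps_var j * f) m = ('X_j * ps_trunc (mdeg m).+2 f)@_m.
  rewrite (@ps_mulE (mdeg m).+2) //; congr (_@_m); congr (_ * _).
  apply/mpolyP => k; rewrite mcoeff_trunc mcoeffX /= eq_sym.
  by case: eqP => [<-|]; rewrite ?mdeg1 //= if_same.
have le1 : (U_(j) <= m)%MM.
  by apply/mnm_lepP => i; rewrite mnm1E; case: eqP => // <-.
rewrite -{1}(submK le1) addmC mulrC mcoeffMX mcoeff_trunc.
by rewrite ltnS (leq_trans (mdegB _ _)).
Qed.

(* f lies in the k-th power of the ideal generated by the variables. *)
Fixpoint in_mpow (k : nat) (f : {powser R[n]}) : Prop :=
  if k is k'.+1 then
    exists g : 'I_n -> {powser R[n]},
      (forall j, in_mpow k' (g j)) /\ f = \sum_j ps_var j * g j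
  else True.

Lemma in_mpowP k f :
  in_mpow k f <-> forall m, (mdeg m < k)%N -> pscoef f m = 0.
Proof.
elim: k f => [|k IHk] f //=; split=> [[g [gk ->]] m ltm|f0].
  rewrite pscoef_sum big1 // => j _; rewrite pscoef_varM.
  case: ifP => // mj; apply: (IHk _).1 (gk j) _ _.
  have le1 : (U_(j) <= m)%MM.
    by apply/mnm_lepP => i; rewrite mnm1E; case: eqP => // <-.
  by move: ltm; rewrite -{1}(submK le1) mdegD mdeg1 addn1.
pose pk (m : 'X_{1..n}) := [pick j | (0 < m j)%N].
pose g j := PowSer (fun m =>
  if pk (m + U_(j))%MM == Some j then pscoef f (m + U_(j))%MM else 0).
exists g; split=> [j|].
  apply/IHk => m ltm /=; rewrite f0 ?if_same //.
  by rewrite mdegD mdeg1 addn1.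
apply: powserP => m; rewrite pscoef_sum.
under eq_bigr => j _ do rewrite pscoef_varM /=.
transitivity (\sum_j if pk m == Some j then pscoef f m else 0); last first.
  apply: eq_bigr => j _; case: (boolP (0 < m j)%N) => mj.
    have le1 : (U_(j) <= m)%MM.
      by apply/mnm_lepP => i; rewrite mnm1E; case: eqP => // <-.
    by rewrite submK.
  rewrite /pk; case: pickP => [i mi|//].
  by case: eqP => // -[ij]; move: mj; rewrite -ij mi.
rewrite -big_mkcond /= /pk; case: pickP => [i mi|m0] /=.
  by rewrite (big_pred1 i) // => j; apply/eqP/eqP => [[->]|->].
rewrite big_pred0 // f0 //.
suff -> : m = 0%MM by rewrite mdeg0.
by apply/mnmP => j; rewrite mnm0E; apply/eqP; rewrite eqn0Ngt m0.
Qed.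

Lemma ps_neq0P f : f != 0 -> exists k, `[< ~ in_mpow k.+1 f >].
Proof.
move=> f0; apply: contrapT => nk; case/eqP: f0; apply: powserP => m.
rewrite pscoef0; suff /in_mpowP : in_mpow (mdeg m).+1 f by apply.
by apply: contrapT => nm; apply: nk; exists (mdeg m); apply/asboolP.
Qed.

(* The adic order: the largest k such that f lies in the k-th power of the
   maximal ideal, that is the least k such that f is not in the next one. *)
Definition mord f : \bar int :=
  if pselect (exists k, `[< ~ in_mpow k.+1 f >]) is left e
  then (Posz (ex_minn e))%:E else +oo%E.

Lemma mord0 : mord 0 = +oo%E.
Proof.
rewrite /mord; case: pselect => // e; exfalso; case: e => k /asboolP[].
by apply/in_mpowP => m _; rewrite pscoef0.
Qed.

Lemma mord_neq0 f : f != 0 -> exists d : nat,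
  [/\ mord f = (Posz d)%:E, forall m, (mdeg m < d)%N -> pscoef f m = 0
    & ps_hcomp d f != 0].
Proof.
move=> /ps_neq0P ek; rewrite /mord; case: pselect => // e.
case: ex_minnP => d /asboolP nd dmin; exists d.
have fd : in_mpow d f.
  case: d nd dmin => // d _ dmin; apply: contrapT => nd.
  by have := dmin d; rewrite ltnn => /(_ (asboolT nd)).
split=> //; first exact/in_mpowP.
apply: contra_notN nd => /eqP h0; apply/in_mpowP => m.
rewrite ltnS leq_eqVlt => /orP[/eqP dm|]; last exact: (in_mpowP _ _).1 fd m.
by have := mcoeff_hcomp d f m; rewrite h0 mcoeff0 dm eqxx => <-.
Qed.

Lemma mord_uniq f d :
    (forall m, (mdeg m < d)%N -> pscoef f m = 0) -> ps_hcomp d f != 0 ->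
  mord f = (Posz d)%:E.
Proof.
move=> fd hd; have [|e [-> fe he]] := @mord_neq0 f.
  apply: contraNneq hd => ->; apply/eqP/mpolyP => m.
  by rewrite mcoeff_hcomp pscoef0 if_same mcoeff0.
have aux a b : (forall m, (mdeg m < a)%N -> pscoef f m = 0) ->
    ps_hcomp b f != 0 -> (a <= b)%N.
  move=> fa; rewrite leqNgt; apply: contraNN => ltba.
  apply/eqP/mpolyP => m; rewrite mcoeff_hcomp mcoeff0.
  by case: eqP => // mb; rewrite fa ?mb.
by congr (Posz _)%:E; apply/eqP; rewrite eqn_leq !aux.
Qed.

End Ring.

Section IDomain.
Variables (n : nat) (R : idomainType).
Implicit Types f g : {powser R[n]}.

Let mulf_aux f g : f != 0 -> g != 0 -> mord (f * g) = (mord f + mord g)%E.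
Proof.
move=> /mord_neq0[d [-> fd hf]] /mord_neq0[e [-> ge hg]].
rewrite (@mord_uniq _ _ _ (d + e)%N) //; first exact: pscoefM_lt.
by rewrite ps_hcompM // mulf_neq0.
Qed.

Let mulf_eq0 f g : f * g = 0 -> (f == 0) || (g == 0).
Proof.
move=> fg0; apply/norP => -[f0 g0]; have := mulf_aux f0 g0.
have [d [-> _ _]] := mord_neq0 f0; have [e [-> _ _]] := mord_neq0 g0.
by rewrite fg0 mord0.
Qed.

HB.instance Definition _ :=
  GRing.ComUnitRing_isIntegral.Build {powser R[n]} mulf_eq0.

Lemma mordM f g : mord (f * g) = (mord f + mord g)%E.
Proof.
have [->|f0] := eqVneq f 0.
  by rewrite mul0r mord0; have [->|/mord_neq0[d [-> _ _]]] := eqVneq g 0;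
     rewrite ?mord0.
have [->|g0] := eqVneq g 0; last exact: mulf_aux.
by rewrite mulr0 mord0; have [d [-> _ _]] := mord_neq0 f0.
Qed.

(* Extension to the fraction field; by fracmordE the value does not depend on
   the representative x / y. *)
Definition fracmord (z : {fraction {powser R[n]}}) : \bar int :=
  (mord (\n_(repr z))%R - mord (\d_(repr z))%R)%E.

Lemma fracmordE f g : g != 0 -> fracmord (f%:F / g%:F) = (mord f - mord g)%E.
Proof.
move=> g0; rewrite /fracmord; set z := _ / _.
set a := (\n_(repr z))%R; set b := (\d_(repr z))%R.
have b0 : b != 0 by exact: denom_ratioP.
suff : a%:F / b%:F = z.
  rewrite /z => /eqP.
  rewrite eqr_div ?tofrac_eq0 // -!tofracM tofrac_eq => /eqP.
  move=> /(congr1 (@mord n R)); rewrite !mordM.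
  have [d [-> _ _]] := mord_neq0 b0; have [e [-> _ _]] := mord_neq0 g0.
  case: (mord a) (mord f) => [x| |] [y| |] //= [] xy.
  congr EFin; apply/eqP; rewrite subr_eq addrAC eq_sym subr_eq -xy; exact/eqP.
have fracE (u v : {powser R[n]}) : v != 0 ->
    u%:F / v%:F = \pi_({fraction {powser R[n]}}) (Ratio u v).
  move=> v0; rewrite -[LHS]/(FracField.mul u%:F (FracField.inv v%:F)) !piE.
  rewrite /FracField.mulf /FracField.invf !numden_Ratio ?oner_eq0 // ?mul1r ?mulr1 //.
by rewrite fracE // Ratio_numden reprK.
Qed.

End IDomain.

Arguments fracmord {n R} z%_ring_scope.

(* k(T_1/T_N, ..., T_(N-1)/T_N)[[T_N]]: the N.-1 variables of {mpoly k[N.-1]}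
   stand for the quotients T_j / T_N, and the power series variable for T_N. *)
Notation vhat k N := {powser {fraction {mpoly k[N.-1]}}[1]}.

Section VHat.
Variables (k : fieldType) (N : nat).
Implicit Types f g : {powser k[N]}.

(* T_i / T_N, which is 1 when T_i is the last variable T_N. *)
Definition Tquot (i : 'I_N) : {mpoly k[N.-1]} :=
  if insub (val i) is Some j then 'X_j else 1.

(* The inclusion of k[[T_1, ..., T_N]] in vhat: if f is the sum of its
   homogeneous components f_d, then f is the sum over d of
   f_d(T_1/T_N, ..., T_(N-1)/T_N, 1) * T_N^d. *)
Definition to_vhat f : vhat k N := PowSer (fun e =>
  (ps_hcomp (mdeg e) f \mPo [tuple Tquot i | i < N])%:F).

Let hcompB d : {morph @ps_hcomp N k d : f g / f - g}.
Proof.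
move=> f g; apply/mpolyP => m; rewrite mcoeffB !mcoeff_hcomp pscoefB.
by case: ifP => // _; rewrite subr0.
Qed.

Let to_vhatB : zmod_morphism to_vhat.
Proof.
by move=> f g; apply: powserP => e /=; rewrite hcompB !raddfB.
Qed.

Let mdeg_1 (e e' : 'X_{1..1}) : mdeg e = mdeg e' -> e = e'.
Proof.
rewrite !mdegE !big_ord1 => ee; apply/mnmP => i; by rewrite ord1.
Qed.

Let hcompM1 f g (e : 'X_{1..1}) : ps_hcomp (mdeg e) (f * g) =
  \sum_(c : 'X_{1..1 < (mdeg e).+1, (mdeg e).+1} | e == (c.1 + c.2)%MM)
    ps_hcomp (mdeg c.1) f * ps_hcomp (mdeg c.2) g.
Proof.
apply/mpolyP => m; rewrite mcoeff_hcomp (raddf_sum (mcoeff m)).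
rewrite [RHS](eq_bigr _ (fun c _ => mcoeffM _ _ m)).
rewrite [RHS]exchange_big /=; case: eqP => [me|/eqP me]; last first.
  rewrite big1 // => -[a b] /= /eqP mab; rewrite big1 // => -[c d] /= /eqP ecd.
  rewrite !mcoeff_hcomp; case: eqP => [ac|]; last by rewrite mul0r.
  case: eqP => [bd|]; last by rewrite mulr0.
  have : mdeg (a + b)%MM = mdeg (c + d)%MM by rewrite !mdegD ac bd.
  by rewrite -mab -ecd; move/eqP: me.
apply: eq_bigr => -[a b] /= /eqP mab.
have dab : (mdeg a + mdeg b)%N = mdeg e by rewrite -mdegD -mab.
have mdegU r : mdeg (U_(ord0 : 'I_1) *+ r)%MM = r by rewrite mdegMn mdeg1 mul1n.
have lta : (mdeg (U_(ord0 : 'I_1) *+ mdeg a)%MM < (mdeg e).+1)%N.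
  by rewrite mdegU ltnS -dab leq_addr.
have ltb : (mdeg (U_(ord0 : 'I_1) *+ mdeg b)%MM < (mdeg e).+1)%N.
  by rewrite mdegU ltnS -dab leq_addl.
rewrite (bigD1 (BMultinom lta, BMultinom ltb)) /=; last first.
  by apply/eqP/mdeg_1; rewrite mdegD !mdegU.
rewrite !mcoeff_hcomp !mdegU !eqxx big1 ?addr0 // => -[c d] /= /andP[_ ncd].
rewrite !mcoeff_hcomp; case: eqP => [ac|]; last by rewrite mul0r.
case: eqP => [bd|]; last by rewrite mulr0.
case/eqP: ncd; congr (_, _); apply/val_inj/mdeg_1; rewrite /= mdegU //.
Qed.

Let to_vhatM : monoid_morphism to_vhat.
Proof.
split=> [|f g]; apply: powserP => e.
  have h1 : @ps_hcomp N k (mdeg e) 1 = (e == 0%MM)%:R.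
    apply/mpolyP => m; rewrite mcoeff_hcomp pscoef1 -!mdeg_eq0.
    rewrite mcoeffMn mcoeff1 -mdeg_eq0.
    have [->|e0] := eqVneq (mdeg e) 0%N; first by case: eqP.
    by case: eqP => // ->; rewrite (negPf e0).
  by rewrite [LHS]/= h1 !rmorph_nat.
rewrite [LHS]/= hcompM1 pscoefM (raddf_sum (comp_mpoly _)) (raddf_sum (@tofrac _)).
by apply: eq_bigr => c _; rewrite [RHS]/= -tofracM -rmorphM.
Qed.

HB.instance Definition _ :=
  GRing.isZmodMorphism.Build {powser k[N]} (vhat k N) to_vhat to_vhatB.
HB.instance Definition _ :=
  GRing.isMonoidMorphism.Build {powser k[N]} (vhat k N) to_vhat to_vhatM.

Definition frac_vhat f : {fraction vhat k N} :=
  (to_vhat f)%:F.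

End VHat.

Lemma comp_TquotX (k : fieldType) N (m : 'X_{1..N.+1}) :
  'X_[m] \mPo [tuple @Tquot k N.+1 i | i < N.+1] =
  'X_[[multinom m (widen_ord (leqnSn N) j) | j < N]].
Proof.
rewrite comp_mpolyX big_ord_recr /= tnth_mktuple /Tquot insubF ?ltnn //.
rewrite expr1n mulr1 mpolyXE_id; apply: eq_bigr => j _.
by rewrite mnmE tnth_mktuple; case: insubP => [i _ /val_inj ->|/negP[]] //=.
Qed.

Lemma mord_to_vhat (k : fieldType) N (f : {powser k[N]}) :
  (0 < N)%N -> mord (to_vhat f) = mord f.
Proof.
case: N f => // N f _; have [->|/mord_neq0[d [-> fd hd]]] := eqVneq f 0.
  by rewrite raddf0 !mord0.
apply: mord_uniq => [e lte|].
  rewrite /=; suff -> : ps_hcomp (mdeg e) f = 0 by rewrite !raddf0.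
  apply/mpolyP => m; rewrite mcoeff_hcomp mcoeff0.
  by case: eqP => // me; rewrite fd ?me.
have mdegU : mdeg (U_(ord0 : 'I_1) *+ d)%MM = d by rewrite mdegMn mdeg1 mul1n.
apply: contraNneq hd => /mpolyP/(_ (U_(ord0 : 'I_1) *+ d)%MM).
rewrite mcoeff_hcomp mdegU eqxx mcoeff0 /= mdegU => /eqP.
rewrite tofrac_eq0 => /eqP h0; apply/eqP/mpolyP => m; rewrite mcoeff0.
rewrite mcoeff_hcomp; case: eqP => // dm.
pose res (m : 'X_{1..N.+1}) := [multinom m (widen_ord (leqnSn N) j) | j < N].
have := congr1 (mcoeff (res m)) h0; rewrite mcoeff0 => <-.
rewrite /ps_hcomp (raddf_sum (comp_mpoly _)) (raddf_sum (mcoeff _)).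
have ltm : (mdeg m < d.+1)%N by rewrite dm.
rewrite (bigD1 (BMultinom ltm)) /= ?dm // comp_mpolyZ comp_TquotX mcoeffZ.
rewrite mcoeffX eqxx mulr1 big1 ?addr0 // => -[m' ltm'] /= /andP[/eqP dm' neq].
rewrite comp_mpolyZ comp_TquotX mcoeffZ mcoeffX.
case: eqP => [eqres|]; last by rewrite mulr0.
case/eqP: neq; apply: val_inj => /=.
have eqw (j : 'I_N) : m' (widen_ord (leqnSn N) j) = m (widen_ord (leqnSn N) j).
  by have /mnmP/(_ j) := eqres; rewrite !mnmE.
apply/mnmP => i; case: (unliftP ord_max i) => [j ->|->].
  by have := eqw j; congr (_ = _); congr (_ _); apply: val_inj;
     rewrite /= /bump leqNgt ltn_ord.
move: dm'; rewrite -dm !mdegE !big_ord_recr /= (eq_bigr _ (fun j _ => eqw j)).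
by move/addnI.
Qed.

Section Artin.
Variables (k : fieldType) (N n : nat).
Implicit Types (F : seq {mpoly {powser k[N]}[n]}) (P : {mpoly {powser k[N]}[n]}).

(* beta has the strong approximation property for the ideal generated by F. *)
Definition approximates F (beta : nat -> nat) : Prop :=
  forall (i : nat) (x : 'I_n -> {powser k[N]}),
    (forall f, f \in F -> in_mpow (beta i).+1 f.@[x]) ->
  exists xb : 'I_n -> {powser k[N]},
    (forall f, f \in F -> f.@[xb] = 0) /\
    (forall j, in_mpow i.+1 (xb j - x j)).

Definition is_artin_function F (beta : nat -> nat) : Prop :=
  approximates F beta /\
  forall gamma, approximates F gamma -> forall i, (beta i <= gamma i)%N.

Lemma is_artin_function_uniq F beta gamma :
  is_artin_function F beta -> is_artin_function F gamma -> beta =1 gamma.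
Proof.
move=> [ab minb] [ag ming] i; apply/eqP.
by rewrite eqn_leq minb // ming.
Qed.

Definition affinely_bounded (R : realType) (beta : nat -> nat) : Prop :=
  exists lam mu : R, forall i : nat, (beta i)%:R <= lam * i%:R + mu.

(* P with X_i replaced by 1; the remaining variables X_(lift i j) are
   renumbered as 'X_j with j : 'I_n.-1. *)
Definition subst_one (i : 'I_n) P : {mpoly {powser k[N]}[n.-1]} :=
  P \mPo [tuple if unlift i l is Some j then 'X_j else 1 | l < n].

(* Evaluation, at a point of vhat, of a polynomial over k[[T_1, ..., T_N]]. *)
Definition eval_vhat m (Q : {mpoly {powser k[N]}[m]}) (y : 'I_m -> vhat k N) :
  vhat k N := mmap (@to_vhat k N) y Q.

End Artin.

(* Main.v *)
(* With x_i the coordinate of x of least order, P(x) is x_i^d times the value of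
   Q_i at the quotients x_j / x_i, which lie in the complete valuation ring. The
   equivalence thus amounts to comparing ord Q_i(z) with the distance from z to
   the roots of Q_i. One comparison is the congruence Q_i(z) = Q_i(y) modulo
   z - y; the other is Greenberg's linear approximation theorem over K[[T]].

   The latter is obtained by compactness. Sequences of elements of K[[T]],
   modulo those whose order exceeds, along an ultrafilter, every multiple of a
   given positive weight, form a domain whose fraction field is a separable
   extension of K((T)), because K((T)) is complete. Hence a zero of Q in this domain can be lifted, one coordinate at a
   time and by Hensel's lemma, to the ultrapower of K[[T]]. *)

Require Import Defs.
From HB Require Import structures.
From mathcomp Require Import all_boot all_order all_algebra fraction.
From mathcomp Require Import mpoly zify ring.
From mathcomp Require Import boolp classical_sets functions filter.
From mathcomp Require Import reals constructive_ereal.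

Set Implicit Arguments.
Unset Strict Implicit.
Unset Printing Implicit Defensive.

Import Order.TTheory GRing.Theory Num.Theory.
Local Open Scope ring_scope.

(** * Ideals and polynomial substitutions *)

Section IdealTheory.
Variable S : comNzRingType.

Record is_ideal (I : S -> Prop) : Prop := IsIdeal {
  ideal0 : I 0;
  idealD : forall x y, I x -> I y -> I (x + y);
  idealMl : forall x y, I y -> I (x * y) }.

Variable I : S -> Prop.
Hypothesis idI : is_ideal I.

Lemma idealMr x y : I x -> I (x * y).
Proof. by move=> Ix; rewrite mulrC; apply: (idealMl idI). Qed.

Lemma idealN x : I x -> I (- x).
Proof. by move=> Ix; rewrite -mulN1r; apply: (idealMl idI). Qed.

Lemma idealB x y : I x -> I y -> I (x - y).
Proof. by move=> Ix Iy; apply: (idealD idI) => //; apply: idealN. Qed.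

Lemma idealBC x y : I (x - y) -> I (y - x).
Proof. by move=> /idealN; rewrite opprB. Qed.

Lemma ideal_congr x y : I (x - y) -> I y -> I x.
Proof. by move=> Ixy Iy; rewrite -(subrK y x); apply: (idealD idI). Qed.

Lemma ideal_sum J (r : seq J) (P : pred J) (F : J -> S) :
  (forall j, P j -> I (F j)) -> I (\sum_(j <- r | P j) F j).
Proof.
by move=> IF; apply: big_ind IF => [|x y]; [apply: (ideal0 idI)|apply: (idealD idI)].
Qed.

Lemma ideal_congM x x' y y' :
  I (x - x') -> I (y - y') -> I (x * y - x' * y').
Proof.
move=> Ix Iy; have -> : x * y - x' * y' = (x - x') * y + x' * (y - y').
  by rewrite mulrBl mulrBr addrA subrK.
by apply: (idealD idI); [apply: idealMr|apply: (idealMl idI)].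
Qed.

Lemma ideal_congX x x' m : I (x - x') -> I (x ^+ m - x' ^+ m).
Proof.
move=> Ix; elim: m => [|m IHm]; first by rewrite subrr; apply: (ideal0 idI).
by rewrite !exprS; apply: ideal_congM.
Qed.

Lemma ideal_horner (q : {poly S}) x : (forall i, I q`_i) -> I q.[x].
Proof.
by move=> Iq; rewrite horner_coef; apply: ideal_sum => i _; apply: idealMr.
Qed.

Lemma ideal_horner_congr (q : {poly S}) x y : I (x - y) -> I (q.[x] - q.[y]).
Proof.
move=> Ixy; rewrite !horner_coef -sumrB; apply: ideal_sum => i _.
by rewrite -mulrBr; apply: (idealMl idI); apply: ideal_congX.
Qed.

Lemma ideal_mmap (A : nzRingType) (f : {rmorphism A -> S}) n
    (y z : 'I_n -> S) F :
  (forall i, I (y i - z i)) -> I (mmap f y F - mmap f z F).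
Proof.
move=> Iyz; rewrite /mmap -sumrB; apply: ideal_sum => m _.
rewrite -mulrBr; apply: (idealMl idI); rewrite /mmap1.
elim/big_rec2: _ => [|i a b _ Iab]; first by rewrite subrr; apply: (ideal0 idI).
by apply: ideal_congM => //; apply: ideal_congX.
Qed.

End IdealTheory.

Section MpolyMorphisms.
Variables (n : nat) (A : comNzRingType) (S : comNzRingType).

Lemma rmorph_mpolyE (g : {rmorphism {mpoly A[n]} -> S}) F :
  g F = mmap (g \o @mpolyC n A) (fun i => g 'X_i) F.
Proof.
rewrite {1}(mpolyE F) rmorph_sum; apply: eq_bigr => m _.
rewrite -mul_mpolyC [LHS]rmorphM mpolyXE_id rmorph_prod; congr (_ * _).
by apply: eq_bigr => i _; rewrite rmorphXn.
Qed.

Lemma eq_mmap (f g : A -> S) (y z : 'I_n -> S) F :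
  f =1 g -> y =1 z -> mmap f y F = mmap g z F.
Proof. by move=> efg eyz; apply: eq_bigr => m _; rewrite efg (mmap1_eq _ eyz). Qed.

Lemma mmapXU (f : {rmorphism A -> S}) (y : 'I_n -> S) i :
  mmap f y 'X_i = y i.
Proof. by rewrite mmapX mmap1U. Qed.

End MpolyMorphisms.

Section Univariate.
Variables (n : nat) (A B : comNzRingType) (f : {rmorphism A -> B}).
Variables (b : 'I_n -> B) (i : 'I_n.+1).
Implicit Types (F : {mpoly A[n.+1]}).

(* F as a polynomial in X_i, with the b j substituted for the other variables. *)
Definition univ F : {poly B} :=
  mmap (polyC \o f) (fun l => if unlift i l is Some j then (b j)%:P else 'X) F.

Let univ_is_zmod_morphism : zmod_morphism univ.
Proof. exact: raddfB. Qed.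

Let univ_is_monoid_morphism : monoid_morphism univ.
Proof. by split; [exact: rmorph1|exact: rmorphM]. Qed.

HB.instance Definition _ := GRing.isZmodMorphism.Build
  {mpoly A[n.+1]} {poly B} univ univ_is_zmod_morphism.
HB.instance Definition _ := GRing.isMonoidMorphism.Build
  {mpoly A[n.+1]} {poly B} univ univ_is_monoid_morphism.

Lemma univC c : univ c%:MP = (f c)%:P.
Proof. by rewrite /univ mmapC. Qed.

Lemma univXU l : univ 'X_l = if unlift i l is Some j then (b j)%:P else 'X.
Proof. by rewrite /univ mmapXU. Qed.

Lemma univZX c m : univ (c *: 'X_[m]) =
  (f c * \prod_j b j ^+ m (lift i j))%:P * 'X^(m i).
Proof.
rewrite /univ mmapZ mmapX /mmap1 (bigD1_ord i) //= unlift_none mulrCA mulrC.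
rewrite polyCM rmorph_prod; congr (_ * _ * _); apply: eq_bigr => j _.
by rewrite liftK rmorphXn.
Qed.

Lemma deriv_univ F : (univ F)^`() = univ F^`M(i).
Proof.
rewrite {1}(mpolyE F) !rmorph_sum (raddf_sum (@deriv _)) /=.
apply: eq_bigr => m _; rewrite !univZX derivM derivC mul0r add0r derivXn.
rewrite mulrnAr -mulrnAl -polyCMn mnmBE mnm1E eqxx subn1.
rewrite mulr_natl (raddfMn f) mulrnAl; congr (polyC (_ * _ *+ _) * _).
by apply: eq_bigr => j _; rewrite mnmBE mnm1E (negPf (neq_lift _ _)) subn0.
Qed.

End Univariate.

(** Lets the induction on n in [small_lift] treat a relation in n + 1 variables as a univariate one
    over the other coordinates. *)
Lemma mmap_univ n (A S : comNzRingType) (f : {rmorphism A -> S})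
    (y : 'I_n.+1 -> S) i F :
  mmap f y F = (map_poly (mmap f (fun j => y (lift i j)))
                      (univ (@mpolyC n A) (@mpolyX n A \o mnm1) i F)).[y i].
Proof.
pose g := horner_eval (y i) \o map_poly (mmap f (fun j => y (lift i j)))
  \o univ (@mpolyC n A) (@mpolyX n A \o mnm1) i.
rewrite -[RHS]/(g F) [RHS]rmorph_mpolyE; apply: eq_mmap => [a|l] /=.
  by rewrite univC map_polyC /= mmapC /horner_eval hornerC.
rewrite univXU; case: unliftP => [j ->|->].
  by rewrite map_polyC /= mmapXU /horner_eval hornerC.
by rewrite map_polyX /horner_eval hornerX.
Qed.

Lemma msize_mderiv n (A : nzRingType) (F : {mpoly A[n]}) i :
  (msize F^`M(i) <= (msize F).-1)%N.
Proof.
rewrite msizeE; apply/bigmax_leqP_seq => m mF _.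
have : (m + U_(i))%MM \in msupp F.
  rewrite mcoeff_msupp; apply: contraTneq mF => e.
  by rewrite mcoeff_msupp mcoeff_deriv e mul0rn eqxx.
move/msize_mdeg_lt; rewrite mdegD mdeg1 addn1; case: (msize F) => //.
Qed.

(** * Lifting zeros along a Henselian prime *)

Section Lifting.
Variables (A : idomainType) (S : comNzRingType) (iota : {rmorphism A -> S}).
(** In the application [S] is the ring of sequences in K[[T]] and [null] consists of those vanishing
    along an ultrafilter, so that [S] modulo [null] is the ultrapower. *)
Variables (small null : S -> Prop).
Hypotheses (id_small : is_ideal small) (id_null : is_ideal null).
Hypothesis small_prime : forall x y, small (x * y) -> small x \/ small y.
Hypothesis null_cancel : forall c x, ~ small c -> null (c * x) -> null x.
Hypothesis small_inj : forall a, small (iota a) -> a = 0.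
Hypothesis small_hensel : forall (f : {poly S}) a,
  small f.[a] -> ~ small f^`().[a] -> exists2 b, null f.[b] & small (b - a).
(* Separability of the fraction field of S / small over the one of A, in the
   sense of MacLane. *)
Hypothesis small_separable : forall p, p \in [pchar A] ->
  forall s (a : 'I_s -> A),
    (exists2 c : 'I_s -> A, exists i, c i != 0 & \sum_i a i * c i ^+ p = 0) \/
    (forall x : 'I_s -> S, small (\sum_i iota (a i) * x i ^+ p) ->
       forall i, small (x i)).

Lemma not_smallX c m : ~ small c -> ~ small (c ^+ m).
Proof.
move=> nc; elim: m => [|m IHm]; last by rewrite exprS => /small_prime[].
rewrite expr0 -(rmorph1 iota) => /small_inj /eqP; by rewrite oner_eq0.
Qed.

Section MinimalRelation.
Variables (n : nat) (z : 'I_n -> S) (F : {mpoly A[n]}).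
Hypotheses (F0 : F != 0) (Fz : small (mmap iota z F)).
Hypothesis minF :
  forall G : {mpoly A[n]}, G != 0 -> small (mmap iota z G) -> (msize F <= msize G)%N.

(** Induction on s. In the second case of [small_separable] every [g i] is small at [z], hence zero
    by minimality of [F]. In the first, a relation with [c i0 != 0] eliminates the summand [i0], and
    the new [g' j] still have size below that of [F]. *)
Lemma pcomb_minimal_eq0 p s (a : 'I_s -> A) (g : 'I_s -> {mpoly A[n]}) :
    p \in [pchar A] -> (forall i, (msize (g i) < msize F)%N) ->
    small (\sum_i iota (a i) * mmap iota z (g i) ^+ p) ->
  \sum_i a i *: g i ^+ p = 0.
Proof.
move=> pA; elim: s a g => [|s IHs] a g gF gz; first by rewrite big_ord0.
have [[c [i0 ci0] ac0]|/(_ _ gz) gz0] := small_separable pA a; last first.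
  rewrite big1 // => i _; have [->|gi0] := eqVneq (g i) 0.
    by rewrite expr0n gtn_eqF ?scaler0 // prime_gt0 // (pcharf_prime pA).
  by have := minF gi0 (gz0 i); rewrite leqNgt gF.
have pM : p \in [pchar {mpoly A[n]}] by rewrite (rmorph_pchar (@mpolyC n A)).
pose a' j := a (lift i0 j).
pose g' j := c i0 *: g (lift i0 j) - c (lift i0 j) *: g i0.
have eXp j : g' j ^+ p = c i0 ^+ p *: g (lift i0 j) ^+ p
                         - c (lift i0 j) ^+ p *: g i0 ^+ p.
  rewrite /g' exprDn_pchar; last by rewrite pnatE ?(pcharf_prime pA).
  rewrite exprNn_pchar ?exprZn //.
  by rewrite pnatE ?(pcharf_prime pA).
(* By the relation, the sum of the [- a j * c j ^+ p] over j != i0 is [a i0 * c i0 ^+ p], which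
   restores the missing summand. *)
have e : \sum_j a' j *: g' j ^+ p = c i0 ^+ p *: \sum_i a i *: g i ^+ p.
  under eq_bigr => j _ do rewrite eXp scalerBr !scalerA.
  rewrite sumrB -scaler_suml [in RHS](bigD1_ord i0) //= scalerDr.
  rewrite -[X in - (X *: _)](addKr (a i0 * c i0 ^+ p)).
  have := ac0; rewrite (bigD1_ord i0) //= => ->.
  rewrite addr0 scaleNr opprK addrC scalerA mulrC; congr (_ + _).
  by rewrite scaler_sumr; apply: eq_bigr => j _; rewrite scalerA mulrC.
have := IHs a' g'; rewrite e => H.
have /eqP : c i0 ^+ p *: \sum_i a i *: g i ^+ p = 0.
  apply: H => [j|].
    rewrite /g' (leq_ltn_trans (msizeD_le _ _)) // msizeN gtn_max.
    by rewrite !(leq_ltn_trans (msizeZ_le _ _)).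
  have -> : \sum_j iota (a' j) * mmap iota z (g' j) ^+ p
            = mmap iota z (\sum_j a' j *: g' j ^+ p).
    by rewrite rmorph_sum; apply: eq_bigr => j _; rewrite /= mmapZ rmorphXn.
  rewrite e mmapZ rmorph_sum; apply: (idealMl id_small).
  by under eq_bigr => j _ do rewrite /= mmapZ rmorphXn.
by rewrite -mul_mpolyC mulf_eq0 mpolyC_eq0 expf_eq0 (negPf ci0) andbF => /eqP.
Qed.

(* If all derivatives were small they would vanish by minimality, and F would
   be a combination of p-th powers of polynomials of smaller degree. *)
Lemma minimal_deriv_not_small : exists i, ~ small (mmap iota z F^`M(i)).
Proof.
apply: contrapT => /forallNP dz.
have sF : (0 < msize F)%N by rewrite lt0n msize_poly_eq0.
have d0 i : F^`M(i) = 0.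
  apply: contrapT => /eqP di0; have := minF di0 (contrapT (dz i)).
  apply/negP; rewrite -ltnNge; apply: leq_ltn_trans (msize_mderiv _ _) _.
  by rewrite ltn_predL.
have cm0 m i : F@_m *+ m i = 0.
  case mi : (m i) => [|q] //; have /mpolyP/(_ (m - U_(i))%MM) := d0 i.
  rewrite mcoeff_deriv mcoeff0 mnmBE mnm1E eqxx mi subn1 /= submK //.
  by apply/mnm_lepP => j; rewrite mnm1E; case: eqP => // <-; rewrite mi.
have [m mF m0] : exists2 m, m \in msupp F & m != 0%MM.
  apply: contrapT => /forall2NP nm.
  have : (msize F <= 1)%N.
    rewrite msizeE; apply/bigmax_leqP_seq => m mF _.
    by have [//|/negP/negPn/eqP ->] := nm m; rewrite mdeg0.
  move/msize1_polyC => eF; move: Fz F0; rewrite eF mmapC => /small_inj ->.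
  by rewrite eqxx.
have [i mi] : exists i, m i != 0%N.
  apply: contrapT => /forallNP mi; case/eqP: m0; apply/mnmP => i.
  by rewrite mnm0E; apply/eqP/negPn/negP.
have nz m' : m' \in msupp F -> forall j, (m' j)%:R == 0 :> A.
  rewrite mcoeff_msupp => cm' j; have /eqP := cm0 m' j.
  by rewrite -[F@_m' *+ _]mulr_natr mulf_eq0 (negPf cm').
(* The positive integer [m i] vanishes in [A], so the characteristic is a prime p, which divides
   every exponent in [F]. *)
have [p pA] := natf0_pchar (etrans (lt0n _) mi) (nz m mF i).
have p1 : (1 < p)%N by rewrite prime_gt1 ?(pcharf_prime pA).
have pm m' : m' \in msupp F -> forall j, (p %| m' j)%N.
  by move=> m'F j; rewrite (dvdn_pcharf pA) nz.
pose dm (m' : 'X_{1..n}) := [multinom (m' j %/ p)%N | j < n].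
have dmK m' : m' \in msupp F -> 'X_[dm m'] ^+ p = 'X_[m'] :> {mpoly A[n]}.
  move=> m'F; rewrite mpolyXn; congr 'X_[_]; apply/mnmP => j.
  by rewrite mulmnE mnmE divnK // pm.
pose s := msupp F.
pose a (j : 'I_(size s)) := F@_(tnth (in_tuple s) j).
pose g (j : 'I_(size s)) : {mpoly A[n]} := 'X_[dm (tnth (in_tuple s) j)].
have eF : F = \sum_j a j *: g j ^+ p.
  rewrite {1}(mpolyE F) (big_tnth _ _ s) /=; apply: eq_bigr => j _.
  by rewrite /g dmK // mem_tnth.
case/eqP: F0; rewrite eF; apply: pcomb_minimal_eq0 pA _ _ => [j|].
  rewrite /g msizeX; set m' := tnth _ _.
  have m'F : m' \in msupp F by apply: mem_tnth.
  (* A constant monomial is its own p-th root; its size 1 is below that of [F] because [F] contains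
     the nonconstant [m]. *)
  have [m'0|m'0] := eqVneq m' 0%MM.
    have -> : dm m' = 0%MM by apply/mnmP => l; rewrite mnmE m'0 mnm0E div0n.
    rewrite mdeg0; apply: leq_trans (msize_mdeg_lt mF).
    by rewrite ltnS lt0n mdeg_eq0.
  apply: leq_trans (msize_mdeg_lt m'F); rewrite ltnS.
  have -> : mdeg m' = (mdeg (dm m') * p)%N.
    rewrite !mdegE big_distrl /=; apply: eq_bigr => l _.
    by rewrite mnmE divnK // pm.
  rewrite ltn_Pmulr // lt0n mdeg_eq0; apply: contra_neq m'0 => e.
  apply/mnmP => l; move/mnmP/(_ l): e; rewrite mnmE mnm0E => e.
  by rewrite -(divnK (pm _ m'F l)) e mul0n.
move: Fz; rewrite {1}eF rmorph_sum.
by under eq_bigr => j _ do rewrite /= mmapZ rmorphXn.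
Qed.

End MinimalRelation.

Definition evalp n (y : 'I_n -> S) (x : S) (D : {poly {mpoly A[n]}}) : S :=
  (map_poly (mmap iota y) D).[x].

Lemma evalpD n (y : 'I_n -> S) x (D E : {poly {mpoly A[n]}}) :
  evalp y x (D + E) = evalp y x D + evalp y x E.
Proof. by rewrite /evalp rmorphD hornerD. Qed.

Lemma evalpM n (y : 'I_n -> S) x (D E : {poly {mpoly A[n]}}) :
  evalp y x (D * E) = evalp y x D * evalp y x E.
Proof. by rewrite /evalp rmorphM hornerM. Qed.

Lemma evalpC n (y : 'I_n -> S) x (c : {mpoly A[n]}) : evalp y x c%:P = mmap iota y c.
Proof. by rewrite /evalp map_polyC hornerC. Qed.

Lemma evalp_ideal n (y : 'I_n -> S) x (D : {poly {mpoly A[n]}}) (I : S -> Prop) :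
  is_ideal I -> (forall k, I (mmap iota y D`_k)) -> I (evalp y x D).
Proof. by move=> idI ID; apply: ideal_horner => // k; rewrite coef_map; exact: ID. Qed.

Lemma evalp_small_congr n (y z : 'I_n -> S) x (D : {poly {mpoly A[n]}}) :
  (forall i, small (y i - z i)) -> small (evalp y x D - evalp z x D).
Proof.
move=> yz; rewrite /evalp -hornerN -hornerD; apply: ideal_horner => // k.
by rewrite coefD coefN !coef_map; apply: ideal_mmap.
Qed.

Section UnivariateRelation.
Variables (n : nat) (z : 'I_n -> S) (x : S).
Implicit Types D G H R : {poly {mpoly A[n]}}.

(* A relation satisfied by x over z modulo small, of the degree it displays. *)
Definition proper_relation D :=
  small (evalp z x D) /\ ~ small (mmap iota z (lead_coef D)).

(** Dropping a leading term whose coefficient is small does not change the value modulo [small]; the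
    coefficient of index k survives, so the process stops. *)
Lemma proper_relation_le R k :
    small (evalp z x R) -> ~ small (mmap iota z R`_k) ->
  exists2 D, proper_relation D & (size D <= size R)%N.
Proof.
have [m] := ubnP (size R); elim: m R => // m IHm R leRm Rx Rk.
have [sl|nl] := pselect (small (mmap iota z (lead_coef R))); last by exists R.
have R0 : (0 < size R)%N.
  rewrite lt0n; apply: contra_notN Rk; rewrite size_poly_eq0 => /eqP ->.
  by rewrite coef0 raddf0; apply: ideal0.
pose R' := take_poly (size R).-1 R.
have sR' : (size R' <= (size R).-1)%N by apply: size_take_poly.
have eR j : small (mmap iota z (R - R')`_j).
  rewrite coefB coef_take_poly; case: ltnP => lej.
    by rewrite subrr raddf0; apply: ideal0.
  rewrite subr0; move: lej; rewrite leq_eqVlt => /orP[/eqP <-//|ltj].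
  rewrite nth_default ?raddf0; first exact: ideal0.
  by rewrite -(prednK R0).
have [|||D gD sD] := IHm R'.
- by rewrite (leq_ltn_trans sR') // -ltnS prednK.
- apply: (ideal_congr id_small _ Rx); apply: (idealBC id_small).
  rewrite -[R in small (_ R - _)](subrK R') evalpD addrK.
  exact: (evalp_ideal x id_small eR).
- contradict Rk; rewrite -[R](subrK R') coefD raddfD; exact: idealD (eR k) Rk.
by exists D => //; rewrite (leq_trans sD) // (leq_trans sR') // leq_pred.
Qed.

Section MinimalProperRelation.
Variable D : {poly {mpoly A[n]}}.
Hypothesis properD : proper_relation D.
Hypothesis minD : forall E, proper_relation E -> (size D <= size E)%N.

(** Pseudo-division by [D]: a remainder with a coefficient that is not small would yield a proper
    relation shorter than [D]. *)
Lemma proper_relation_div G : small (evalp z x G) ->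
  exists m H R, (lead_coef D ^+ m)%:P * G = H * D + R /\
    forall k, small (mmap iota z R`_k).
Proof.
move=> Gx; have [Dx Dl] := properD.
have D0 : D != 0.
  apply: contra_notN Dl => /eqP ->.
  by rewrite lead_coef0 raddf0; apply: ideal0.
have := Pdiv.ComRing.rdivp_eq D G.
set m := Pdiv.Ring.rscalp _ _; set H := Pdiv.Ring.rdivp _ _.
set R := Pdiv.Ring.rmodp _ _; rewrite -mul_polyC => eG; exists m, H, R.
split=> // k; apply: contrapT => Rk.
have [|E properE] := @proper_relation_le R k _ Rk.
  have -> : R = (lead_coef D ^+ m)%:P * G + - H * D.
    by rewrite eG mulNr addrAC subrr add0r.
  by rewrite evalpD !evalpM; apply: idealD => //; apply: idealMl.
apply/negP; rewrite -ltnNge; apply: leq_trans (minD properE).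
exact: Pdiv.Ring.ltn_rmodpN0.
Qed.

(** Differentiate the pseudo-division identity: at [x], modulo [small], only the multiple of the
    derivative of [D] remains on the right. *)
Lemma proper_relation_deriv G :
  small (evalp z x G) -> ~ small (evalp z x G^`()) -> ~ small (evalp z x D^`()).
Proof.
move=> Gx G'x D'x; have [Dx Dl] := properD.
have [m [H [R [/(congr1 (@deriv _)) + Rk]]]] := proper_relation_div Gx.
rewrite !(derivM, derivD) derivC mul0r add0r => /(congr1 (evalp z x)).
rewrite !(evalpM, evalpD) evalpC rmorphXn => e.
have : small (mmap iota z (lead_coef D) ^+ m * evalp z x G^`()).
  rewrite e; apply: (idealD id_small); last first.
    apply: evalp_ideal => // k; rewrite coef_deriv raddfMn /= -mulr_natl.
    exact: idealMl.
  by apply: (idealD id_small); apply: idealMl.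
by case/small_prime => //; apply: not_smallX.
Qed.

End MinimalProperRelation.

Lemma minimal_proper_relation R k :
    small (evalp z x R) -> ~ small (mmap iota z R`_k) ->
  exists2 D, proper_relation D &
    forall E, proper_relation E -> (size D <= size E)%N.
Proof.
move=> Rx Rk; have [D gD _] := proper_relation_le Rx Rk.
pose P m := `[< exists2 D, proper_relation D & size D = m >].
have eP : exists m, P m by exists (size D); apply/asboolP; exists D.
case: (ex_minnP eP) => m /asboolP[D0 gD0 <-] minm; exists D0 => // E gE.
by apply: minm; apply/asboolP; exists E.
Qed.

End UnivariateRelation.

(* By induction on n: among the z i, one is a simple root of a polynomial over
   the others modulo small. Once the others are lifted, Hensel's lemma lifts
   that root, and division by a relation of minimal degree shows that all
   relations lift with it. *)
Lemma small_lift n (z : 'I_n -> S) :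
  exists2 y : 'I_n -> S, forall i, small (y i - z i) &
    forall F, small (mmap iota z F) -> null (mmap iota y F).
Proof.
elim: n z => [|n IHn] z.
  exists z => [[]//|F]; rewrite [F](_ : _ = (F@_0)%:MP); last first.
    apply/mpolyP => m; rewrite mcoeffC [m](_ : _ = 0%MM) ?eqxx ?mulr1 //.
    by apply/mnmP => -[].
  by rewrite mmapC => /small_inj ->; rewrite raddf0; apply: ideal0.
have [[F [F0 Fz]]|nF] := pselect (exists F : {mpoly A[n.+1]}, F != 0 /\ small (mmap iota z F));
  last first.
  exists z => [i|F Fz]; first by rewrite subrr; apply: ideal0.
  suff -> : F = 0 by rewrite raddf0; apply: ideal0.
  by apply: contrapT => /eqP F0; apply: nF; exists F.
have {F F0 Fz} [F [F0 Fz minF]] : exists F : {mpoly A[n.+1]}, [/\ F != 0, small (mmap iota z F)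
    & forall G : {mpoly A[n.+1]}, G != 0 -> small (mmap iota z G) ->
        (msize F <= msize G)%N].
  pose P m := `[< exists F : {mpoly A[n.+1]},
    [/\ F != 0, small (mmap iota z F) & msize F = m] >].
  have eP : exists m, P m by exists (msize F); apply/asboolP; exists F.
  case: (ex_minnP eP) => m /asboolP[G [G0 Gz <-]] minm; exists G; split=> //.
  by move=> E E0 Ez; apply: minm; apply/asboolP; exists E.
(* Minimality makes [z i] a simple root, modulo [small], of a univariate polynomial over the other
   coordinates. *)
have [i] := minimal_deriv_not_small F0 Fz minF.
pose U := univ (@mpolyC n A) (@mpolyX n A \o mnm1) i.
pose z' j := z (lift i j).
have UE (G : {mpoly A[n.+1]}) : mmap iota z G = evalp z' (z i) (U G) by rewrite (mmap_univ _ _ i).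
rewrite UE /U -deriv_univ -/U => dF.
have [k Uk] : exists k, ~ small (mmap iota z' (U F)`_k).
  apply: contrapT => /forallNP Uk; apply: dF; apply: evalp_ideal => // k.
  rewrite coef_deriv raddfMn /= -mulr_natl; apply: idealMl => //.
  exact: contrapT (Uk _).
have UFz : small (evalp z' (z i) (U F)) by rewrite -UE.
have [D gD minD] := minimal_proper_relation UFz Uk.
have D'z := proper_relation_deriv gD minD UFz dF; have [Dz Dl] := gD.
have [y' y'z y'null] := IHn z'.
have y'D (E : {poly {mpoly A[n]}}) : small (evalp y' (z i) E - evalp z' (z i) E).
  exact: evalp_small_congr.
have [||b Db bz] := @small_hensel (map_poly (mmap iota y') D) (z i).
- exact: ideal_congr (y'D D) Dz.
- rewrite deriv_map => D'y; apply: D'z; apply: ideal_congr D'y => //.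
  exact: (idealBC id_small (y'D D^`())).
pose y l := if unlift i l is Some j then y' j else b.
exists y => [l|G Gz].
  by rewrite /y; case: unliftP => [j ->|->].
have -> : mmap iota y G = evalp y' b (U G).
  rewrite (mmap_univ _ _ i) /y unlift_none; congr (_.[_]).
  by apply: eq_map_poly => c; apply: eq_mmap => // j; rewrite liftK.
rewrite UE in Gz.
have [m [H [R [/(congr1 (evalp y' b)) e Rk]]]] := proper_relation_div gD minD Gz.
(* The power of the leading coefficient cancels modulo [null]. What remains is null: [D] because [b]
   is a root, and [R] because its coefficients are relations of [z'], lifted by induction. *)
apply: (@null_cancel (mmap iota y' (lead_coef D) ^+ m)).
  apply: not_smallX => Dly; apply: Dl; apply: ideal_congr Dly => //.
  by apply: (idealBC id_small); apply: ideal_mmap.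
move: e; rewrite !(evalpM, evalpD) evalpC rmorphXn => ->.
apply: (idealD id_null); first exact: idealMl.
by apply: evalp_ideal => // k'; apply: y'null.
Qed.
End Lifting.

(** * Power series in one variable *)

Section PowserOrder.
Variables (n : nat) (R : idomainType).
Implicit Types f g : {powser R[n]}.

Lemma in_mpowW l k f : (l <= k)%N -> in_mpow k f -> in_mpow l f.
Proof.
by move=> lek /in_mpowP fk; apply/in_mpowP => m ltm; rewrite fk // (leq_trans ltm).
Qed.

Lemma in_mpow_le_mord k f : in_mpow k f <-> ((Posz k)%:E <= mord f)%E.
Proof.
have [->|/mord_neq0[d [-> fd hd]]] := eqVneq f 0.
  by rewrite mord0 leey; split=> // _; apply/in_mpowP => m _.
rewrite lee_fin lez_nat; split=> [/in_mpowP fk|lekd]; last first.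
  by apply/in_mpowP => m ltm; rewrite fd // (leq_trans ltm).
rewrite leqNgt; apply: contraNN hd => ltdk; apply/eqP/mpolyP => m.
by rewrite mcoeff_hcomp mcoeff0; case: eqP => // md; rewrite fk // md.
Qed.

Lemma in_mpow_ideal k : is_ideal (@in_mpow n R k).
Proof.
split=> [|f g /in_mpowP fk /in_mpowP gk|f g /in_mpowP gk]; apply/in_mpowP => m.
- by [].
- by move=> ltm; rewrite pscoefD fk // gk // addr0.
- by rewrite -[k]add0n; apply: pscoefM_lt.
Qed.

Lemma in_mpowM k l f g : in_mpow k f -> in_mpow l g -> in_mpow (k + l) (f * g).
Proof. by move=> /in_mpowP fk /in_mpowP gl; apply/in_mpowP/pscoefM_lt. Qed.

Lemma in_mpowX k m f : in_mpow k f -> in_mpow (m * k) (f ^+ m).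
Proof.
move=> fk; elim: m => [//|m IHm]; rewrite mulSn exprS; exact: in_mpowM.
Qed.

Lemma in_mpow_eq0 f : (forall k, in_mpow k f) -> f = 0.
Proof.
move=> fk; apply: powserP => m.
exact: (in_mpowP _ _).1 (fk (mdeg m).+1) m (ltnSn _).
Qed.

Lemma in_mpow_cancel k l f g :
  in_mpow (k + l) (f * g) -> ~ in_mpow l.+1 g -> in_mpow k f.
Proof.
rewrite !in_mpow_le_mord mordM.
have [->|/mord_neq0[e [-> _ _]]] := eqVneq g 0; first by rewrite mord0 leey.
have [->|/mord_neq0[d [-> _ _]]] := eqVneq f 0; first by rewrite mord0 leey.
by rewrite -EFinD !lee_fin; lia.
Qed.

Lemma in_mpow_exact f : f != 0 -> exists2 d, in_mpow d f & ~ in_mpow d.+1 f.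
Proof.
move=> f0; have [d [ed _ _]] := mord_neq0 f0; exists d.
  by rewrite in_mpow_le_mord ed.
by rewrite in_mpow_le_mord ed lee_fin; lia.
Qed.

Lemma mord_exact d f : in_mpow d f -> ~ in_mpow d.+1 f -> mord f = (Posz d)%:E.
Proof.
rewrite !in_mpow_le_mord; have [->|/mord_neq0[e [-> _ _]]] := eqVneq f 0.
  by rewrite mord0 leey.
by rewrite !lee_fin => *; congr (Posz _)%:E; lia.
Qed.

Lemma not_in_mpowM k l f g : ~ in_mpow k.+1 f -> ~ in_mpow l.+1 g ->
  ~ in_mpow (k + l).+1 (f * g).
Proof. by move=> fk gl; rewrite -addSn => /in_mpow_cancel/(_ gl). Qed.

Lemma not_in_mpow1 : ~ in_mpow 1 (1 : {powser R[n]}).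
Proof.
move=> /in_mpowP/(_ 0%MM); rewrite mdeg0 pscoef1 eqxx => /(_ isT)/eqP.
by rewrite oner_eq0.
Qed.

Lemma not_in_mpowX k m f : ~ in_mpow k.+1 f -> ~ in_mpow (m * k).+1 (f ^+ m).
Proof.
move=> fk; elim: m => [|m IHm]; first exact: not_in_mpow1.
by rewrite mulSn exprS; apply: not_in_mpowM.
Qed.

Lemma powser_complete (x : nat -> {powser R[n]}) :
  (forall s, in_mpow s (x s.+1 - x s)) -> exists l, forall s, in_mpow s (l - x s).
Proof.
move=> xC; have xC2 s r : in_mpow s (x (s + r)%N - x s).
  elim: r => [|r IHr]; first by rewrite addn0 subrr; apply: ideal0 (in_mpow_ideal s).
  rewrite addnS -(subrKA (x (s + r)%N)).
  by apply: (idealD (in_mpow_ideal s)) IHr; apply: in_mpowW (xC _); rewrite leq_addr.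
(* The coefficient at [m] is stationary from index [mdeg m + 1] on. *)
exists (PowSer (fun m => pscoef (x (mdeg m).+1) m)) => s; apply/in_mpowP => m ltm.
rewrite pscoefB /= -(subnKC ltm); apply/eqP.
by rewrite -oppr_eq0 opprB -pscoefB; apply/eqP/(in_mpowP _ _).1/ltnSn.
Qed.

(** The contraction principle for the adic topology, the source of inverses and of Hensel roots
    below. *)
Lemma powser_fixpoint (phi : {powser R[n]} -> {powser R[n]}) :
    (forall s f g, in_mpow s (f - g) -> in_mpow s.+1 (phi f - phi g)) ->
  exists f, phi f = f.
Proof.
move=> phiC; pose x s := iter s phi 0.
have [|l lx] := @powser_complete x.
  by elim=> [//|s IHs]; rewrite /x !iterS; apply: phiC.
exists l; apply/eqP; rewrite -subr_eq0; apply/eqP/in_mpow_eq0 => -[//|s].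
rewrite -(subrKA (x s.+1)); apply: (idealD (in_mpow_ideal s.+1)).
  by rewrite /x iterS; apply/phiC/lx.
exact: (idealBC (in_mpow_ideal s.+1) (lx s.+1)).
Qed.

End PowserOrder.

Arguments in_mpow_ideal {n R} k.

(** * Division, Hensel's lemma and p-th powers in K[[T]] *)

Section DVR.
Variable K : fieldType.
Local Notation A := {powser K[1]}.
Implicit Types (f g : A).

Definition unif : A := ps_var K ord0.

Lemma unif_in : in_mpow 1 unif.
Proof.
apply/in_mpowP => m; rewrite ltnS leqn0 mdeg_eq0 => /eqP -> /=.
by case: eqP => // /mnmP/(_ ord0); rewrite mnm0E mnm1E.
Qed.

Lemma unif_notin : ~ in_mpow 2 unif.
Proof.
move=> /in_mpowP/(_ U_(ord0)%MM); rewrite mdeg1 /= eqxx => /(_ isT)/eqP.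
by rewrite oner_eq0.
Qed.

Lemma unifX_in m : in_mpow m (unif ^+ m).
Proof. by rewrite -[m in in_mpow m]muln1; apply/in_mpowX/unif_in. Qed.

Lemma unifX_notin m : ~ in_mpow m.+1 (unif ^+ m).
Proof. by rewrite -[m in in_mpow m.+1]muln1; apply/not_in_mpowX/unif_notin. Qed.

Lemma in_mpow_unif k f : in_mpow k f -> exists g, f = unif ^+ k * g.
Proof.
elim: k f => [|k IHk] f; first by exists f; rewrite expr0 mul1r.
move=> [g [gk ->]]; rewrite big_ord1; have [h ->] := IHk _ (gk ord0).
by exists h; rewrite mulrA -exprS.
Qed.

Lemma powser_unit f : ~ in_mpow 1 f -> exists g, f * g = 1.
Proof.
move=> f1; have c0 : pscoef f 0%MM != 0.
  apply/eqP => f0; apply/f1/in_mpowP => m.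
  by rewrite ltnS leqn0 mdeg_eq0 => /eqP ->.
(* Only the constant coefficient of [g0] matters: it puts [1 - f * g0] in the maximal ideal. The
   fixed point v below then satisfies v * f * g0 = 1. *)
pose g0 : A := PowSer (fun=> (pscoef f 0%MM)^-1).
have fg0 : in_mpow 1 (1 - f * g0).
  apply/in_mpowP => m; rewrite ltnS leqn0 mdeg_eq0 => /eqP ->.
  rewrite pscoefB pscoef1 eqxx (@ps_mulE _ _ 1) ?mdeg0 // rmorphM /=.
  by rewrite !mcoeff_trunc mdeg0 /= divff // subrr.
have [|v ev] := @powser_fixpoint 1 K (fun v => v * (1 - f * g0) + 1).
  move=> s v w vw; rewrite opprD addrACA subrr addr0 -mulrBl -(addn1 s).
  exact: in_mpowM.
exists (g0 * v); move/eqP: ev.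
rewrite mulrBr mulr1 -addrA -[X in _ == X]addr0 (inj_eq (addrI v)) addrC.
by rewrite subr_eq0 mulrC mulrA => /eqP.
Qed.

Lemma powser_div d f g : in_mpow d f -> ~ in_mpow d.+1 g -> exists h, f = h * g.
Proof.
move=> fd gd; have [e ge ge1] : exists2 e, in_mpow e g & ~ in_mpow e.+1 g.
  apply: in_mpow_exact; apply: contra_notN gd => /eqP ->.
  exact: (ideal0 (in_mpow_ideal d.+1)).
have led : (e <= d)%N.
  by rewrite leqNgt; apply/negP => ltde; apply: gd; apply: in_mpowW ge.
have [g' eg] := in_mpow_unif ge; have [f' ef] := in_mpow_unif (in_mpowW led fd).
have [|u g'u] := @powser_unit g'.
  move=> g'1; apply: ge1; rewrite eg -(addn1 e); apply: in_mpowM => //; exact: unifX_in.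
by exists (f' * u); rewrite ef eg mulrACA mulrC -(mulrA f') (mulrC u) g'u mulr1 mulrC.
Qed.

Lemma poly_taylor2 (S : comNzRingType) (p : {poly S}) (a : S) :
  exists q : {poly S}, forall y, p.[a + y] = p.[a] + p^`().[a] * y + y ^+ 2 * q.[y].
Proof.
exists (drop_poly 2 (p \Po ('X + a%:P))) => y.
have {1}-> : p.[a + y] = (p \Po ('X + a%:P)).[y] by rewrite horner_comp !hornerE addrC.
rewrite -{1}(poly_take_drop 2 (p \Po ('X + a%:P))) hornerD hornerM hornerXn.
rewrite [X in _ + X]mulrC; congr (_ + _).
rewrite /take_poly horner_poly big_ord_recl big_ord1 /= expr0 mulr1 expr1 -horner_coef0.
rewrite horner_comp !hornerE; congr (_ + _ * _).
have := coef_deriv (p \Po ('X + a%:P)) 0; rewrite mulr1n => <-.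
by rewrite -horner_coef0 deriv_comp hornerM horner_comp derivD derivX derivC !hornerE.
Qed.

(** Newton's method with f'(a) = D possibly not a unit. Write f(a) = D^2 T h' and b = a + D T w; the
    Taylor expansion of f(b) is D^2 T (h' + w + T g(w)), so a root comes from a fixed point of w ->
    - (h' + T g(w)). *)
Lemma powser_hensel (f : {poly A}) a e :
    ~ in_mpow e.+1 f^`().[a] -> in_mpow (2 * e).+1 f.[a] ->
  exists2 b, f.[b] = 0 & forall k, in_mpow (e + k) f.[a] -> in_mpow k (b - a).
Proof.
set D := f^`().[a] => De fa.
have D2 : ~ in_mpow (2 * e).+1 (D ^+ 2) by apply: not_in_mpowX.
have [h eh] := powser_div (in_mpowW (leqnSn _) fa) D2.
have [|h' eh'] := @in_mpow_unif 1 h.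
  by apply: (@in_mpow_cancel _ _ _ (2 * e) _ (D ^+ 2)) => //; rewrite add1n -eh.
rewrite expr1 in eh'; have [q taylor] := poly_taylor2 f a.
pose g := 'X ^+ 2 * (q \Po ((D * unif) *: 'X)).
have [|w ew] := @powser_fixpoint 1 K (fun w => - (h' + unif * g.[w])).
  move=> s v w vw; rewrite opprK addrC opprD addrACA subrr add0r.
  rewrite -mulrBr -(add1n s); apply: in_mpowM unif_in _.
  apply: (idealBC (in_mpow_ideal s)); exact: (ideal_horner_congr (in_mpow_ideal s)).
have gw : g.[w] = w ^+ 2 * q.[D * unif * w].
  by rewrite /g hornerM hornerXn horner_comp hornerZ hornerX.
set Q := q.[_] in gw; have {ew gw} ew : h' + unif * (w ^+ 2 * Q) = - w.
  by rewrite -gw -[RHS]/(- w) -[in RHS]ew opprK.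
exists (a + D * unif * w) => [|k fk].
  rewrite taylor eh eh' -/D -/Q.
  transitivity (D ^+ 2 * unif * (h' + unif * (w ^+ 2 * Q) + w)); first by ring.
  by rewrite ew addNr mulr0.
have : in_mpow k (D * h).
  apply: (@in_mpow_cancel _ _ _ e _ D) => //.
  by rewrite addnC mulrAC -expr2 mulrC -eh.
rewrite addrC addKr => Dh.
(* The fixed point equation says that b - a times the unit 1 + T w Q equals - D h. *)
apply: (@in_mpow_cancel _ _ _ 0 _ (1 + unif * (w * Q))).
  rewrite addn0; have -> : D * unif * w * (1 + unif * (w * Q)) =
      D * unif * (h' + unif * (w ^+ 2 * Q) + w) - D * h by rewrite eh'; ring.
  by rewrite ew addNr mulr0 sub0r; apply: (idealN (in_mpow_ideal k)).
move=> u1; apply: (@not_in_mpow1 1 K).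
apply: (ideal_congr (in_mpow_ideal 1) _ u1); rewrite opprD addrA subrr add0r -mulrN.
exact: (@in_mpowM _ _ 1 0 _ _ unif_in).
Qed.

Section Separability.
Variable p : nat.
Hypothesis pA : p \in [pchar A].

Let p0 : (0 < p)%N. Proof. by rewrite prime_gt0 // (pcharf_prime pA). Qed.

Lemma exprB_powser_pchar f g : (f - g) ^+ p = f ^+ p - g ^+ p.
Proof.
have pN : [pchar A].-nat p by rewrite pnatE // (pcharf_prime pA).
by rewrite exprDn_pchar // exprNn_pchar.
Qed.

(* The norms on a finite dimensional space over the complete field of p-th
   powers are equivalent: the a_i are either dependent over it, or they span
   a space on which the order controls the orders of the coordinates. *)
Lemma powser_separable s (a : 'I_s -> A) :
  (exists2 c : 'I_s -> A, exists i, c i != 0 & \sum_i a i * c i ^+ p = 0) \/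
  (exists C, forall (b : 'I_s -> A) e,
     in_mpow (C + p * e) (\sum_i a i * b i ^+ p) -> forall i, in_mpow e (b i)).
Proof.
elim: s a => [|s IHs] a; first by right; exists 0%N => b e _ [].
pose a0 := a ord0; pose a' j := a (lift ord0 j).
pose cons (x : A) (y : 'I_s -> A) l := if unlift ord0 l is Some j then y j else x.
have cons0 x y : cons x y ord0 = x by rewrite /cons unlift_none.
have consS x y j : cons x y (lift ord0 j) = y j by rewrite /cons liftK.
have sum_cons x y : \sum_i a i * cons x y i ^+ p
    = a0 * x ^+ p + \sum_j a' j * y j ^+ p.
  by rewrite big_ord_recl cons0; congr (_ + _); apply: eq_bigr => j _; rewrite consS.
have [[c [i ci] ac]|[C bound]] := IHs a'.
  left; exists (cons 0 c); first by exists (lift ord0 i); rewrite consS.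
  by rewrite sum_cons ac expr0n gtn_eqF // mulr0 addr0.
(* Is T^(C p) a0 within order M of the span of the [a'] over p-th powers? The factor T^C supplies
   the precision that [bound] loses. *)
pose rel M (b : 'I_s -> A) :=
  in_mpow M (a0 * (unif ^+ C) ^+ p + \sum_j a' j * b j ^+ p).
have [relM|] := pselect (forall M, exists b, rel M b); last first.
  move=> /existsNP[M0 /forallNP nrel]; right; exists (M0 + C)%N => b e.
  rewrite big_ord_recl -/a0; set b0 := b ord0; pose b' j := b (lift ord0 j).
  rewrite -/(b' _); set T := \sum_(j < s) _ => inT.
  have b0e : in_mpow (e + C) b0.
    (* If b0 had order f < e + C, scaling by q = T^(C + f) / b0 and then dividing by T^f would solve
       [rel M0]. *)
    apply: contrapT => nb0; have b00 : b0 != 0.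
      apply: contra_notN nb0 => /eqP ->; exact: (ideal0 (in_mpow_ideal _)).
    have [f fb fb1] := in_mpow_exact b00.
    have ltf : (f < e + C)%N.
      by rewrite ltnNge; apply: contra_notN nb0 => lef; apply: in_mpowW fb.
    have [q eq] : exists q, unif ^+ (C + f) = q * b0.
      by apply: powser_div fb1; apply: in_mpowW (unifX_in _); rewrite leq_addl.
    have qC : in_mpow C q.
      by apply: (@in_mpow_cancel _ _ _ f _ b0) => //; rewrite -eq; apply: unifX_in.
    have eT : q ^+ p * (a0 * b0 ^+ p + T) =
        a0 * (unif ^+ (C + f)) ^+ p + \sum_j a' j * (q * b' j) ^+ p.
      rewrite eq mulrDr; congr (_ + _); first by rewrite exprMn mulrCA.
      by rewrite mulr_sumr; apply: eq_bigr => j _; rewrite exprMn mulrCA.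
    have inqT := in_mpowM (in_mpowX p qC) inT; rewrite eT in inqT.
    have qb j : in_mpow f (q * b' j).
      apply: (bound (fun j => q * b' j)).
      rewrite -[X in in_mpow _ X](addKr (a0 * (unif ^+ (C + f)) ^+ p)).
      apply: (idealD (in_mpow_ideal _)).
        apply: (idealN (in_mpow_ideal _)); apply: (idealMl (in_mpow_ideal _)).
        apply: in_mpowW (in_mpowX p (unifX_in _)); nia.
      apply: in_mpowW inqT; nia.
    have /choice[b'' eb''] : forall j, exists g, q * b' j = unif ^+ f * g.
      by move=> j; apply: in_mpow_unif.
    apply: (nrel b''); rewrite /rel.
    apply: (@in_mpow_cancel _ _ _ (p * f) _ (unif ^+ f ^+ p)); last first.
      by apply/not_in_mpowX/unifX_notin.
    suff -> : (a0 * (unif ^+ C) ^+ p + \sum_j a' j * b'' j ^+ p) * unif ^+ f ^+ p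
        = a0 * (unif ^+ (C + f)) ^+ p + \sum_j a' j * (q * b' j) ^+ p.
      apply: in_mpowW inqT; nia.
    rewrite mulrDl exprD exprMn mulrA; congr (_ + _).
    by rewrite mulr_suml; apply: eq_bigr => j _; rewrite eb'' exprMn -mulrA [X in _ * X]mulrC.
  (* Now a0 b0^p has order at least p (e + C) >= C + p e, so it can be subtracted before applying
     [bound]. *)
  have b'e : forall j, in_mpow e (b' j).
    apply: bound; rewrite -/T -[X in in_mpow _ X](addKr (a0 * b0 ^+ p)).
    apply: (idealD (in_mpow_ideal _)).
      apply: (idealN (in_mpow_ideal _)); apply: (idealMl (in_mpow_ideal _)).
      apply: in_mpowW (in_mpowX p b0e); nia.
    apply: in_mpowW inT; nia.
  move=> i; case: (unliftP ord0 i) => [j ->|->]; first exact: b'e.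
  by apply: in_mpowW b0e; rewrite leq_addr.
(* By [bound], solutions at these precisions form a Cauchy sequence; its limit is a dependence
   relation whose coefficient at [ord0] is T^C. *)
left; have /choice[b relb] : forall m, exists b, rel (C + p * m)%N b.
  by move=> m; apply: relM.
have /choice[l lim] : forall j, exists l, forall m, in_mpow m (l - b m j).
  move=> j; apply: powser_complete => m.
  apply: (bound (fun j => b m.+1 j - b m j)).
  under eq_bigr => h _ do rewrite exprB_powser_pchar mulrBr.
  rewrite sumrB; set U := bigop _ _ _; set V := bigop _ _ _.
  have -> : U - V = (a0 * unif ^+ C ^+ p + U) - (a0 * unif ^+ C ^+ p + V).
    by rewrite opprD addrACA subrr add0r.
  apply: (idealB (in_mpow_ideal (C + p * m))); last exact: relb.
  apply: in_mpowW (relb m.+1); nia.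
exists (cons (unif ^+ C) l).
  exists ord0; rewrite cons0; apply: contra_notN (@unifX_notin C) => /eqP ->.
  exact: (ideal0 (in_mpow_ideal _)).
rewrite sum_cons; apply: in_mpow_eq0 => m.
have relbm : rel m (b m) by apply: in_mpowW (relb m); nia.
apply: (ideal_congr (in_mpow_ideal m) _ relbm).
rewrite opprD addrACA subrr add0r -sumrB; apply: (ideal_sum (in_mpow_ideal m)) => j _.
by rewrite -mulrBr; apply/(idealMl (in_mpow_ideal m))/(ideal_congX (in_mpow_ideal m)).
Qed.

End Separability.

End DVR.

(** * Greenberg's theorem *)

Section Sequences.
Variable A : comNzRingType.

Definition seq_cst (a : A) : nat -> A := fun=> a.
Definition seq_at (l : nat) (x : nat -> A) : A := x l.

Let seq_cst_zmod : zmod_morphism seq_cst. Proof. by []. Qed.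
Let seq_cst_monoid : monoid_morphism seq_cst. Proof. by []. Qed.
HB.instance Definition _ :=
  GRing.isZmodMorphism.Build A (nat -> A) seq_cst seq_cst_zmod.
HB.instance Definition _ :=
  GRing.isMonoidMorphism.Build A (nat -> A) seq_cst seq_cst_monoid.

Let seq_at_zmod l : zmod_morphism (seq_at l). Proof. by []. Qed.
Let seq_at_monoid l : monoid_morphism (seq_at l). Proof. by []. Qed.
HB.instance Definition _ l :=
  GRing.isZmodMorphism.Build (nat -> A) A (seq_at l) (@seq_at_zmod l).
HB.instance Definition _ l :=
  GRing.isMonoidMorphism.Build (nat -> A) A (seq_at l) (@seq_at_monoid l).

Lemma seq_at_mmap n (z : 'I_n -> nat -> A) F l :
  seq_at l (mmap seq_cst z F) = F.@[fun i => z i l].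
Proof.
rewrite -[LHS]/((seq_at l \o mmap seq_cst z) F) [LHS]rmorph_mpolyE.
by apply: eq_mmap => [a|i] /=; rewrite ?mmapC ?mmapXU.
Qed.

End Sequences.

(** * Sequences in K[[T]] along an ultrafilter *)

Section Ultraproduct.
Variables (K : fieldType) (U : set_system nat) (w : nat -> nat).
Local Open Scope classical_set_scope.
Local Open Scope ring_scope.
Hypotheses (UU : UltraFilter U) (w0 : forall l, (0 < w l)%N).
Local Notation A := {powser K[1]}.
Implicit Types x y : nat -> A.

Definition seq_small x := forall c, U [set l | in_mpow (c * w l) (x l)].
Definition seq_null x := U [set l | x l = 0].

Lemma seq_small_ideal : is_ideal seq_small.
Proof.
split=> [c|x y xs ys c|x y ys c].
- by apply: filterS filterT => l _ /=; apply: (ideal0 (in_mpow_ideal (c * w l))).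
- apply: filterS (filterI (xs c) (ys c)) => l [].
  exact: (idealD (in_mpow_ideal (c * w l))).
- by apply: filterS (ys c) => l /=; apply: (idealMl (in_mpow_ideal (c * w l))).
Qed.

Lemma seq_null_ideal : is_ideal seq_null.
Proof.
split=> [|x y xn yn|x y yn].
- by apply: filterS filterT => l _ /=.
- apply: filterS (filterI xn yn) => l [] /= ex ey.
  by rewrite -[LHS]/(x l + y l) ex ey addr0.
- by apply: filterS yn => l /= ey; rewrite -[LHS]/(x l * y l) ey mulr0.
Qed.

(** Maximality of the ultrafilter turns a failure into a bound on the order that holds almost
    everywhere; primality and cancellation rest on it. *)
Lemma not_seq_small x :
  ~ seq_small x -> exists c, U [set l | ~ in_mpow (c * w l) (x l)].
Proof.
move=> /existsNP[c nc]; exists c.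
by have [|//] := in_ultra_setVsetC [set l | in_mpow (c * w l) (x l)] UU.
Qed.

Lemma seq_small_prime x y : seq_small (x * y) -> seq_small x \/ seq_small y.
Proof.
move=> xys; have [|/not_seq_small[c nx]] := pselect (seq_small x); first by left.
right=> c'; apply: filterS (filterI nx (xys (c' + c)%N)) => l [/= nxl].
rewrite mulnDl -[(x * y) l]/(x l * y l) mulrC => /in_mpow_cancel; apply.
by apply: contra_not nxl; apply: in_mpowW (leqnSn _).
Qed.

Lemma seq_null_cancel x y : ~ seq_small x -> seq_null (x * y) -> seq_null y.
Proof.
move=> /not_seq_small[c nx] xyn; apply: filterS (filterI nx xyn) => l [/= nxl].
rewrite -[(x * y) l]/(x l * y l) => /eqP; rewrite mulf_eq0 => /orP[/eqP xl|/eqP //].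
by case: nxl; rewrite xl; apply: (ideal0 (in_mpow_ideal (c * w l))).
Qed.

Lemma seq_small_inj a : seq_small (seq_cst a) -> a = 0.
Proof.
move=> sa; apply: contrapT => /eqP /in_mpow_exact[d _]; apply.
have [l al] := filter_ex (sa d.+1).
by apply: in_mpowW (al : in_mpow _ a); rewrite leq_pmulr.
Qed.

Lemma seq_small_hensel (f : {poly nat -> A}) x :
    seq_small f.[x] -> ~ seq_small f^`().[x] ->
  exists2 y, seq_null f.[y] & seq_small (y - x).
Proof.
move=> fs /not_seq_small[c f's]; pose fl l := map_poly (@seq_at _ l) f.
have fE l (z : nat -> A) : (fl l).[z l] = f.[z] l.
  by rewrite /fl -[z l]/(seq_at l z) horner_map.
have f'E l : (fl l)^`().[x l] = f^`().[x] l.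
  by rewrite /fl deriv_map -[x l]/(seq_at l x) horner_map.
have /choice[y yP] : forall l, exists b,
    ~ in_mpow (c * w l) (fl l)^`().[x l] ->
    in_mpow (2 * (c * w l)).+1 (fl l).[x l] ->
    (fl l).[b] = 0 /\
    forall k, in_mpow (c * w l + k) (fl l).[x l] -> in_mpow k (b - x l).
  move=> l; have [D|nD] := pselect (~ in_mpow (c * w l) (fl l)^`().[x l]); last first.
    by exists 0.
  have [F|nF] := pselect (in_mpow (2 * (c * w l)).+1 (fl l).[x l]); last by exists 0.
  have [|b fb bx] := powser_hensel _ F; last by exists b.
  by apply: contra_not D; apply: in_mpowW (leqnSn _).
have yU : U [set l | (fl l).[y l] = 0 /\
    forall k, in_mpow (c * w l + k) (fl l).[x l] -> in_mpow k (y l - x l)].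
  (* As [w l] is positive, (2 c + 1) w l >= 2 c w l + 1, the order that Hensel's lemma requires. *)
  apply: filterS (filterI f's (fs (2 * c).+1)) => l [/= D F].
  apply: yP; rewrite ?f'E ?fE //; apply: in_mpowW F.
  by have := w0 l; nia.
exists y.
  by apply: filterS yU => l [/= fy _]; rewrite -fE.
move=> d; apply: filterS (filterI yU (fs (c + d)%N)) => l [/= [_ yk]].
by rewrite mulnDl -fE => /yk.
Qed.

Lemma seq_small_separable p : p \in [pchar A] -> forall s (a : 'I_s -> A),
  (exists2 c : 'I_s -> A, exists i, c i != 0 & \sum_i a i * c i ^+ p = 0) \/
  (forall x : 'I_s -> nat -> A, seq_small (\sum_i seq_cst (a i) * x i ^+ p) ->
     forall i, seq_small (x i)).
Proof.
move=> pA s a; have [|[C bound]] := powser_separable pA a; first by left.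
(* As [w l] is positive, (C + p c) w l >= C + p (c w l): the weight absorbs the constant C. *)
right=> x xs i c; apply: filterS (xs (C + p * c)%N) => l /= xl.
apply: (bound (fun i => x i l)).
have -> : \sum_i a i * x i l ^+ p
    = seq_at l (\sum_i seq_cst (a i) * x i ^+ p).
  by rewrite rmorph_sum; apply: eq_bigr => j _; rewrite rmorphM rmorphXn.
by apply: in_mpowW xl; have := w0 l; nia.
Qed.

End Ultraproduct.

(* A sequence of counterexamples, with c tending to infinity, would be a zero
   of Q modulo seq_small; lifting it to a zero modulo seq_null gives roots of Q
   close to almost all terms of the sequence. *)
Theorem greenberg (K : fieldType) n (Q : {mpoly {powser K[1]}[n]}) :
  exists c, forall m (z : 'I_n -> {powser K[1]}), (0 < m)%N ->
    in_mpow (c * m) Q.@[z] ->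
  exists2 y, Q.@[y] = 0 & forall i, in_mpow m (y i - z i).
Proof.
apply: contrapT => /forallNP nQ.
have /choice[wz wzP] : forall c, exists wz : nat * ('I_n -> {powser K[1]}),
    [/\ (0 < wz.1)%N, in_mpow (c * wz.1) Q.@[wz.2] &
     ~ exists2 y, Q.@[y] = 0 & forall i, in_mpow wz.1 (y i - wz.2 i)].
  move=> c; have /existsNP[w /existsNP[z /not_implyP[w0 /not_implyP[Qz ny]]]] := nQ c.
  by exists (w, z).
pose w l := (wz l).1; pose z i l := (wz l).2 i.
have w0 l : (0 < w l)%N by case: (wzP l).
have [U [UU ooU]] := ultraFilterLemma eventually_filter.
have [y yz yQ] := small_lift (seq_small_ideal K w UU) (seq_null_ideal K UU)
  (seq_small_prime UU) (seq_null_cancel UU) (seq_small_inj UU w0)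
  (seq_small_hensel UU w0) (seq_small_separable UU w0) z.
have Qz : seq_small U w (mmap (@seq_cst _) z Q).
  (* [U] contains the set of all l >= c, where the value of [Q] has order at least l times the
     weight. *)
  move=> c; apply: ooU; exists c => // l /= lec.
  have [_ Ql _] := wzP l; rewrite -[mmap _ _ _ l]/(seq_at l _) seq_at_mmap.
  by apply: in_mpowW Ql; rewrite leq_mul2r lec orbT.
have yzU : U [set l | forall i, in_mpow (w l) (y i l - z i l)]%classic.
  apply: filter_forall => i; apply: filterS (yz i 1%N) => l /=.
  by rewrite mul1n.
have [l [/= yzl Qyl]] := filter_ex (filterI yzU (yQ Q Qz)).
have [_ _] := wzP l; apply; exists (fun i => y i l) => //.
by rewrite -seq_at_mmap.
Qed.

(** * Artin functions *)

Lemma le_er_map_intr (R : realDomainType) (m : nat) (x : \bar int) :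
  ((Posz m)%:E <= x)%E = ((m%:R : R)%:E <= er_map intr x)%E.
Proof.
case: x => [x| |] /=; rewrite ?leey //.
by rewrite !lee_fin -[m%:R]/((Posz m)%:~R) ler_int.
Qed.

Lemma in_mpow_to_vhat (k : fieldType) N m (f : {powser k[N]}) : (0 < N)%N ->
  in_mpow m (to_vhat f) <-> in_mpow m f.
Proof. by move=> N0; rewrite !in_mpow_le_mord mord_to_vhat. Qed.

Section EvalVhat.
Variables (k : fieldType) (N n : nat).
Implicit Types P : {mpoly {powser k[N]}[n]}.

Lemma eval_vhat_meval P (x : 'I_n -> {powser k[N]}) :
  eval_vhat P (fun i => to_vhat (x i)) = to_vhat P.@[x].
Proof.
rewrite -[RHS]/((@to_vhat k N \o meval x) P) [RHS]rmorph_mpolyE.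
by apply: eq_mmap => [c|i] /=; rewrite ?mevalC ?mevalXU.
Qed.

Lemma eval_vhat_map P (y : 'I_n -> vhat k N) :
  eval_vhat P y = (map_mpoly (@to_vhat k N) P).@[y].
Proof.
rewrite -[RHS]/((meval y \o map_mpoly (@to_vhat k N)) P) [RHS]rmorph_mpolyE.
apply: eq_mmap => [c|i] /=; first by rewrite /map_mpoly mmapC /= mevalC.
by rewrite /map_mpoly mmapXU mevalXU.
Qed.

Lemma eval_vhat_homog d P v (z : 'I_n -> vhat k N) : P \is d.-homog ->
  eval_vhat P (fun i => v * z i) = v ^+ d * eval_vhat P z.
Proof.
move=> /dhomogP dP; rewrite /eval_vhat /mmap mulr_sumr !big_seq.
apply: eq_bigr => m mP; rewrite mulrCA; congr (_ * _).
have -> : d = (\sum_i m i)%N by rewrite -mdegE -(dP m mP).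
rewrite /mmap1 expr_sum -big_split /=.
by apply: eq_bigr => i _; rewrite exprMn.
Qed.

Lemma eval_vhat_subst_one i P (y : 'I_n.-1 -> vhat k N) :
  eval_vhat (subst_one i P) y =
  eval_vhat P (fun l => if unlift i l is Some j then y j else 1).
Proof.
rewrite /eval_vhat /subst_one; set lq := [tuple _ | l < n].
rewrite -[LHS]/((mmap (@to_vhat k N) y \o comp_mpoly lq) P) [LHS]rmorph_mpolyE.
apply: eq_mmap => [c|l] /=; first by rewrite comp_mpolyC mmapC.
rewrite comp_mpolyXU -tnth_nth tnth_mktuple.
by case: unlift => [j|]; [rewrite mmapXU | rewrite rmorph1].
Qed.

Lemma eval_vhat_dehomog d P i (x : 'I_n -> {powser k[N]}) z : P \is d.-homog ->
    (forall j, to_vhat (x (lift i j)) = z j * to_vhat (x i)) ->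
  to_vhat P.@[x] = to_vhat (x i) ^+ d * eval_vhat (subst_one i P) z.
Proof.
move=> dP xz; rewrite -eval_vhat_meval eval_vhat_subst_one -(eval_vhat_homog _ _ dP).
apply: eq_mmap => // l; case: unliftP => [j ->|->]; last by rewrite mulr1.
by rewrite xz mulrC.
Qed.

Lemma fracmord_approx (u v : {powser k[N]}) (z y : vhat k N) : (0 < N)%N ->
    v != 0 -> to_vhat u = z * to_vhat v ->
  fracmord (frac_vhat u / frac_vhat v - y%:F) = mord (z - y).
Proof.
move=> N0 v0 uz; have v0' : to_vhat v != 0.
  apply: contra_neq v0 => v0; apply: in_mpow_eq0 => m.
  by apply/(in_mpow_to_vhat m v N0); rewrite v0; apply: (ideal0 (in_mpow_ideal m)).
rewrite /frac_vhat uz tofracM mulfK ?tofrac_eq0 // -tofracB.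
rewrite -[X in fracmord X]divr1 -tofrac1 fracmordE ?oner_eq0 //.
by rewrite (mord_exact _ (@not_in_mpow1 _ _)) ?sube0.
Qed.

(** Since y lies in the valuation ring, a nonnegative order of u/v - y forces u/v into that ring as
    well. *)
Lemma fracmord_ge (u v : {powser k[N]}) (y : vhat k N) m : (0 < N)%N ->
    v != 0 -> ((Posz m)%:E <= fracmord (frac_vhat u / frac_vhat v - y%:F))%E ->
  exists2 z, to_vhat u = z * to_vhat v & in_mpow m (z - y).
Proof.
move=> N0 v0; have [e ve ve1] := in_mpow_exact v0.
have v0' : to_vhat v != 0.
  apply: contra_notN ve1 => /eqP v0'; apply/(in_mpow_to_vhat e.+1 v N0).
  by rewrite v0'; apply: (ideal0 (in_mpow_ideal e.+1)).
rewrite -[X in _ - X](mulfK (x := (to_vhat v)%:F)) ?tofrac_eq0 //.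
rewrite -mulrBl -tofracM -tofracB fracmordE // mord_to_vhat // (mord_exact ve ve1).
set r := to_vhat u - _ => le_r.
have re : in_mpow (m + e) r.
  rewrite in_mpow_le_mord; move: le_r.
  have [->|/mord_neq0[q [-> _ _]]] := eqVneq r 0; first by rewrite mord0 leey.
  by rewrite -EFinB !lee_fin; lia.
have nv : ~ in_mpow e.+1 (to_vhat v) by move/(in_mpow_to_vhat _ _ N0).
have [h eh] := powser_div (in_mpowW (leq_addl m e) re) nv.
exists (y + h); first by rewrite mulrDl -eh addrC subrK.
by rewrite addrC addKr; apply: in_mpow_cancel nv; rewrite -eh.
Qed.

End EvalVhat.

Theorem proposition2p1 (R : realType) (k : fieldType) (N n d : nat)
    (P : {mpoly {powser k[N]}[n]}) :
    (0 < N)%N ->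
    P \is d.-homog ->
    (forall x : 'I_n -> {powser k[N]}, P.@[x] = 0 <-> forall j, x j = 0) ->
  (exists beta : nat -> nat,
      is_artin_function [:: P] beta /\ affinely_bounded R beta)
  <->
  (exists a b : R, [/\ 0 < a, 0 < b &
     forall (i : 'I_n) (y : 'I_n.-1 -> vhat k N),
       eval_vhat (subst_one i P) y = 0 ->
     forall (u : 'I_n.-1 -> {powser k[N]}) (v : {powser k[N]}), v != 0 ->
       (er_map intr
          (\big[Order.min/+oo]_(j < n.-1)
             fracmord (frac_vhat (u j) / frac_vhat v - (y j)%:F))
        <= a%:E * er_map intr (mord v) + b%:E)%E]).
Proof.
move=> N0 dP P0; split.
  move=> [beta [[approx _] [lam [mu betaP]]]].
  (* The maxima ensure positivity; the final 1 pays for the exponent [beta e + 1]. *)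
  exists (Num.max lam 1), (Num.max mu 0 + 1); split.
  - by rewrite lt_max ltr01 orbT.
  - by rewrite ltr_wpDl // le_max lexx orbT.
  move=> i y Qy u v v0; have [e [ve _ _]] := mord_neq0 v0.
  rewrite ve /= leNgt; apply/negP => lt_min.
  pose m := (beta e).+1.
  have min_m : ((Posz m)%:E <= \big[Order.min/+oo]_(j < n.-1)
      fracmord (frac_vhat (u j) / frac_vhat v - (y j)%:F))%E.
    rewrite (le_er_map_intr R); apply: le_trans (ltW lt_min).
    rewrite -EFinM -EFinD lee_fin -natr1 addrA lerD2r.
    apply: le_trans (betaP e) _; apply: lerD; last by rewrite le_max lexx.
    by rewrite ler_wpM2r ?ler0n // le_max lexx.
  have /choice[z zP] : forall j, exists z,
      to_vhat (u j) = z * to_vhat v /\ in_mpow m (z - y j).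
    move=> j; have /bigmin_geP[_ /(_ j isT) le_mj] := min_m.
    by have [z] := fracmord_ge N0 v0 le_mj; exists z.
  (* P(x) = v^d Q_i(z) with z = u/v, and Q_i(z) is congruent to Q_i(y) = 0 modulo order m. *)
  pose x l := if unlift i l is Some j then u j else v.
  have xi : x i = v by rewrite /x unlift_none.
  have Px : in_mpow m P.@[x].
    apply/(in_mpow_to_vhat m _ N0); rewrite (eval_vhat_dehomog (i := i) (z := z) dP).
      apply: (idealMl (in_mpow_ideal m)); rewrite -[X in in_mpow m X]subr0 -Qy.
      by apply: (ideal_mmap (in_mpow_ideal m)) => j; case: (zP j).
    by move=> j; rewrite xi /x liftK; case: (zP j).
  have [|xb [Pxb xbx]] := approx e x; first by move=> f; rewrite inE => /eqP ->.
  (* The approximating zero is 0, so v would have order at least e + 1. *)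
  have /P0/(_ i) xbi := Pxb P (mem_head _ _).
  have := xbx i; rewrite xbi xi sub0r => /(idealN (in_mpow_ideal e.+1)).
  by rewrite opprK in_mpow_le_mord ve lee_fin lez_nat ltnn.
move=> [a [b [a0 b0 dioph]]].
have /choice[c cP] : forall i : 'I_n, exists c, forall m z, (0 < m)%N ->
    in_mpow (c * m) (eval_vhat (subst_one i P) z) ->
    exists2 y, eval_vhat (subst_one i P) y = 0 & forall j, in_mpow m (y j - z j).
  move=> i; have [c cP] := greenberg (map_mpoly (@to_vhat k N) (subst_one i P)).
  exists c => m z m0; rewrite eval_vhat_map => /(cP _ _ m0)[y Qy yz].
  by exists y; rewrite ?eval_vhat_map.
pose C := \max_i c i.
pose c0 := maxn (Num.bound a) (Num.bound b).
have ac0 : a <= c0%:R.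
  by apply: le_trans (ltW (archi_boundP (ltW a0))) _; rewrite ler_nat leq_maxl.
have bc0 : b <= c0%:R.
  by apply: le_trans (ltW (archi_boundP (ltW b0))) _; rewrite ler_nat leq_maxr.
(* The term d e pays for dividing P(x) by x_i^d; the rest lets Greenberg's theorem reach a precision
   above a e + b. *)
pose gamma e := (d * e + C * (c0 * e + c0).+1)%N.
have order_bound e x : in_mpow (gamma e).+1 P.@[x] -> forall j, in_mpow e.+1 (x j).
  move=> Px j; apply: contrapT => nxj.
  (* The least such m is the minimal order e' of the coordinates, attained at some x_i, which
     therefore divides all of them in the valuation ring. *)
  pose bad m := `[< exists l, ~ in_mpow m.+1 (x l) >].
  have ebad : exists m, bad m by exists e; apply/asboolP; exists j.
  case: (ex_minnP ebad) => e' /asboolP[i nxi] mine'.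
  have lee' : (e' <= e)%N by apply: mine'; apply/asboolP; exists j.
  have xe' l : in_mpow e' (x l).
    case: e' {nxi lee'} mine' => [//|e'] mine'; apply: contrapT => nxl.
    suff /mine' : bad e' by rewrite ltnn.
    by apply/asboolP; exists l.
  pose v := x i; have v0 : v != 0.
    by apply: contra_notN nxi => /eqP; rewrite -/v => ->; apply: (ideal0 (in_mpow_ideal _)).
  have nv : ~ in_mpow e'.+1 (to_vhat v) by move/(in_mpow_to_vhat _ _ N0).
  have /choice[z xz] : forall l, exists h, to_vhat (x (lift i l)) = h * to_vhat v.
    move=> l; apply: powser_div nv; exact/(in_mpow_to_vhat _ _ N0).
  pose m := (c0 * e + c0).+1.
  have Qz : in_mpow (c i * m) (eval_vhat (subst_one i P) z).
    apply: (@in_mpow_cancel _ _ _ (d * e') _ (to_vhat v ^+ d)); last exact: not_in_mpowX.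
    rewrite mulrC -(eval_vhat_dehomog dP xz); apply/(in_mpow_to_vhat _ _ N0).
    apply: in_mpowW Px; rewrite /gamma -/m.
    have : (c i <= C)%N by apply: leq_bigmax.
    nia.
  have [y Qy yz] := cP i m z (ltn0Sn _) Qz.
  have := dioph i y Qy (fun l => x (lift i l)) v v0.
  rewrite (mord_exact (xe' i) nxi).
  apply/negP; rewrite -ltNge; apply: (@lt_le_trans _ _ (m%:R : R)%:E).
    rewrite /= -EFinM -EFinD lte_fin /m -natr1 natrD natrM.
    apply: (@le_lt_trans _ _ (c0%:R * e%:R + c0%:R)); last by rewrite ltrDl.
    apply: lerD => //; apply: ler_pM => //; first exact: ltW.
    by rewrite -[e%:R]/((Posz e)%:~R) ler_int.
  (* For n = 1 the minimum is empty, with value +oo, and exceeds the bound as well. *)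
  rewrite -le_er_map_intr; apply/bigmin_geP; split=> [|l _]; first exact: leey.
  rewrite (fracmord_approx _ N0 v0 (xz l)) -in_mpow_le_mord.
  exact: (idealBC (in_mpow_ideal m)).
pose good e b' := forall x : 'I_n -> {powser k[N]},
  (forall f, f \in [:: P] -> in_mpow b'.+1 f.@[x]) ->
  exists xb : 'I_n -> {powser k[N]},
    (forall f, f \in [:: P] -> f.@[xb] = 0) /\
    (forall j, in_mpow e.+1 (xb j - x j)).
have approx : approximates [:: P] gamma.
  move=> e x Px; exists (fun=> 0); split=> [f|j].
    by rewrite inE => /eqP ->; apply/P0.
  rewrite sub0r; apply: (idealN (in_mpow_ideal e.+1)); apply: order_bound.
  exact: Px (mem_head _ _).
(* The Artin function is built pointwise as the least good value, which exists because [gamma] is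
   good. *)
have /choice[beta betaP] : forall e, exists b,
    good e b /\ forall b', good e b' -> (b <= b')%N.
  move=> e; have ex : exists b, `[< good e b >].
    by exists (gamma e); apply/asboolP => x; apply: approx.
  case: (ex_minnP ex) => b' /asboolP gb min_b; exists b'; split=> // b'' gb''.
  by apply/min_b/asboolP.
exists beta; split.
  split=> [e x|gamma' approx' e]; first exact: (betaP e).1.
  by apply: (betaP e).2 => x; apply: approx'.
(* These are the slope and the constant term of [gamma]. *)
exists (d + C * c0)%:R, (C * c0.+1)%:R => e; rewrite -natrM -natrD ler_nat.
have /(betaP e).2 : good e (gamma e) by move=> x; apply: approx.
move/leq_trans; apply; rewrite /gamma; nia.
Qed.
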